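(* Let $S$ be a nonempty, closed, convex subset of a Banach space $E$ and let $A, B: S \to \mathcal{P}_{cl,cv}(E)$ be two multi-valued mappings with weakly sequentially closed graphs such that: (i) $A$ is hemi-weakly compact and countably $\beta$-nonexpansive; (ii) $B$ is weakly compact; (iii) $(A+B)(S)$ is a bounded subset of $S$. Then the operator inclusion $u\in A(u)+B(u)$ has at least one solution $u$ in $S$.
   Context: $\mathcal{P}_{cl,cv}(E)$ is the family of all nonempty closed convex subsets of $E$. For a multi-valued $F$ on $S$ and $M\subset S$, $F(M)=\bigcup_{x\in M}F(x)$; $(A+B)(u)=A(u)+B(u)$. $\rightharpoonup$ denotes weak convergence. $F:S\to\mathcal P(E)$ (nonempty subsets) has a weakly sequentially closed graph if whenever $x_n\in S$, $x_n\rightharpoonup x\in S$, $y_n\in F(x_n)$ and $y_n\rightharpoonup y$ in $E$, then $y\in F(x)$. $F$ is hemi-weakly compact if, for every sequence $(x_n)$ in $S$ and every choice $y_n\in F(x_n)$ such that $(x_n-y_n)$ converges weakly, $(x_n)$ has a weakly convergent subsequence. $F$ is weakly compact if $F(M)$ is relatively weakly compact for every bounded $M\subset S$. $\beta$ is the De Blasi measure of weak noncompactness: for bounded $W\subset E$, $\beta(W)=\inf\{\varepsilon>0:\ \exists K\subset E \text{ weakly compact},\ W\subset K+\mathcal{B}_E(\varepsilon)\}$, where $\mathcal{B}_E(\varepsilon)$ is the closed ball of radius $\varepsilon$ centred at the origin. $F$ is countably $\beta$-nonexpansive if $F$ is bounded (maps bounded sets to bounded sets) and $\beta(F(W))\le\beta(W)$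 for every countable bounded subset $W$ of $S$. *)

(* Defs.v *)
From HB Require Import structures.
From mathcomp Require Import all_boot all_order all_algebra.
From mathcomp Require Import all_classical all_reals all_analysis.

Set Implicit Arguments.
Unset Strict Implicit.
Unset Printing Implicit Defensive.

Import Order.TTheory GRing.Theory Num.Theory.
Import numFieldNormedType.Exports.

Local Open Scope classical_set_scope.
Local Open Scope ring_scope.

Definition dual (R : realType) (E : normedModType R) :=
  {f : {linear E -> R^o} | continuous f}.

(* [weak E] is the carrier of [E] with the weak topology: the coarsest topology
   that makes every element of [dual E] continuous. *)
Definition weak (R : realType) (E : normedModType R) : topologicalType :=
  sup_topology (fun f : dual E =>
    Topological.on (initial_topology (sval f : E -> R^o))).

Definition weak_cvg (R : realType) (E : normedModType R) (x : nat -> E) (l : E) :=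
  (x : nat -> weak E) @ \oo --> (l : weak E).

Definition weakly_compact (R : realType) (E : normedModType R) (K : set E) :=
  @compact (weak E) K.

Definition rel_weakly_compact (R : realType) (E : normedModType R) (W : set E) :=
  @precompact (weak E) W.

(* Meant for bounded [W] only: [inf] is a real number, and it takes a junk value
   when no [e] is admissible. *)
Definition de_blasi (R : realType) (E : normedModType R) (W : set E) : R :=
  inf [set e : R | 0 < e /\ exists K : set E, weakly_compact K /\
         W `<=` [set k + b | k in K & b in closed_ball (0 : E) e]].

(* A multi-valued map on [S : set E] is encoded as a function [F : E -> set E]
   of which only the values at the points of [S] are ever used. *)

Definition mimage (E : Type) (F : E -> set E) (M : set E) : set E :=
  \bigcup_(x in M) F x.

Definition madd (E : zmodType) (A B : E -> set E) (u : E) : set E :=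
  [set a + b | a in A u & b in B u].

Definition nonempty_closed_convex (R : realType) (E : normedModType R)
    (C : set E) :=
  [/\ C !=set0, closed C & convex_set C].

Definition weakly_seq_closed_graph (R : realType) (E : normedModType R)
    (S : set E) (F : E -> set E) :=
  forall (x y : nat -> E) (x0 y0 : E),
    (forall n, S (x n)) -> S x0 -> weak_cvg x x0 ->
    (forall n, F (x n) (y n)) -> weak_cvg y y0 -> F x0 y0.

Definition hemi_weakly_compact (R : realType) (E : normedModType R)
    (S : set E) (F : E -> set E) :=
  forall x y : nat -> E,
    (forall n, S (x n)) -> (forall n, F (x n) (y n)) ->
    (exists z : E, weak_cvg (fun n => x n - y n) z) ->
    exists phi : nat -> nat, increasing_seq phi /\
      exists x0 : E, weak_cvg (x \o phi) x0.

Definition weakly_compact_map (R : realType) (E : normedModType R)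
    (S : set E) (F : E -> set E) :=
  forall M : set E, M `<=` S -> bounded_set M -> rel_weakly_compact (mimage F M).

Definition bounded_map (R : realType) (E : normedModType R)
    (S : set E) (F : E -> set E) :=
  forall M : set E, M `<=` S -> bounded_set M -> bounded_set (mimage F M).

Definition countably_beta_nonexpansive (R : realType) (E : normedModType R)
    (S : set E) (F : E -> set E) :=
  bounded_map S F /\
  forall W : set E, W `<=` S -> countable W -> bounded_set W ->
    de_blasi (mimage F W) <= de_blasi W.

(* Main.v *)
(* For 0 < t < 1 put G = t (A + B) + (1 - t) x0 with x0 in S.  Let D be the
   smallest set that contains x0 and is closed under a fixed selection of G and
   under rational convex combinations; D is countable and lies in the convex
   hull of x0 and G(D), so by the Krein-Smulian theorem
   beta(D) <= t beta(A(D)) <= t beta(D), i.e. beta(D) = 0, and the closed convex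
   set K = cl D is weakly compact.  A fixed point of G in K comes from a
   Sperner-type argument applied to finitely many functionals, followed by a
   passage to the limit along weakly convergent subsequences.  Letting t tend to
   1, weak compactness of B and hemi-weak compactness of A make the fixed points
   converge weakly to a solution.

   Krein-Smulian and Grothendieck's criterion are obtained together: an
   ultrafilter on a bounded set W without weak limit yields z_n in W and
   functionals f_m of norm at most 1 with f_m(z_n) > c for m <= n and
   f_m(z_n) = 0 for n < m, and Simons' inequality excludes such sequences. *)
Require Import Defs.
From HB Require Import structures.
From mathcomp Require Import all_boot all_order all_algebra.
Set Implicit Arguments.
Unset Strict Implicit.
Unset Printing Implicit Defensive.

(** * Dominant pairs and a Sperner-type lemma *)

(** The measure of noncompactness is controlled on countable sets only, and the graphs are closed
    for sequences only. Rational weights and a single selection keep D countable; cl D is then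
    separable, so countably many functionals separate its points, and sequences suffice inside K
    although the weak topology need not be metrizable on E. The factor t < 1 turns the nonexpansive
    estimate for A into a contraction. For x in K the set G(x) need not lie in K, it only meets K,
    so the fixed point is sought for the intersection of G(x) with K.

    In the usual proof of the Krein-Smulian theorem functionals are represented by measures and
    limits taken by dominated convergence. Simons' inequality replaces both: a bounded sequence of
    functionals with nonpositive limit superior at each point of a weakly compact set has convex
    combinations that are uniformly small from above.

    As t tends to 1, u - a = b + s (x0 - a - b) with a in A(u), b in B(u), s = 1 - t. By (iii) the
    bracket is bounded, so u - a converges weakly along a subsequence, as hemi-weak compactness
    requires. *)

Section DominantPairs.
Variables (X I : finType) (u : I -> X -> nat).
Hypothesis u_inj : forall i, injective (u i).
Variables (x0 : X) (i0 : I) (c : X -> I).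
Implicit Types (s : {set X}) (J : {set I}) (d r : {set X} * {set I}).

(** Scarf's dominance: for nonempty [s], no point of [X] lies strictly above the minima of [s] in
    all coordinates of [J] at once. The injective [u i] are strict rankings of [X]. *)
Definition dominant s J :=
  [forall y, [exists i in J, [forall x in s, u i y <= u i x]]].

Lemma dominantP s J :
  reflect (forall y, exists2 i, i \in J & forall x, x \in s -> u i y <= u i x) (dominant s J).
Proof.
apply: (iffP forallP) => H y.
  have /existsP[i /andP[iJ /forallP ux]] := H y.
  by exists i => // x xs; have := ux x; rewrite xs.
have [i iJ ux] := H y; apply/existsP; exists i; rewrite iJ /=.
by apply/forallP => x; apply/implyP; exact: ux.
Qed.

Lemma dominantS s s' J J' : s' \subset s -> J \subset J' -> dominant s J -> dominant s' J'.
Proof.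
move=> /subsetP ss /subsetP JJ /dominantP H; apply/dominantP => y.
by have [i iJ ux] := H y; exists i; [exact: JJ|move=> x /ss; exact: ux].
Qed.

Definition room r := dominant r.1 r.2 && (#|r.1| == #|r.2|).
Definition door d := dominant d.1 d.2 && (#|d.2| == #|d.1|.+1).
(** Sperner's almost complete labelling, with [i0] as the missing label; the cardinality in [door]
    forces [c] to be injective on [d.1]. *)
Definition good d := [&& door d, i0 \in d.2 & c @: d.1 == d.2 :\ i0].
Definition adjacent d r :=
  [exists x, (x \notin d.1) && (r == (x |: d.1, d.2))] ||
  [exists j, (j \in d.2) && (r == (d.1, d.2 :\ j))].
Definition edge d r := [&& good d, room r & adjacent d r].

Section Minimum.
Variables (s : {set X}) (J : {set I}) (x1 : X).
Hypotheses (x1s : x1 \in s) (dsJ : dominant s J).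

Let m i := [arg min_(x < x1 in s) u i x].

Let mP i : m i \in s /\ forall x, x \in s -> u i (m i) <= u i x.
Proof. by rewrite /m; case: arg_minnP. Qed.

Let m_eq i x : x \in s -> (forall y, y \in s -> u i x <= u i y) -> m i = x.
Proof.
move=> xs ux; apply: (@u_inj i); apply/eqP; rewrite eqn_leq.
by rewrite (mP i).2// ux//; exact: (mP i).1.
Qed.

Let m_surj : m @: J = s.
Proof.
apply/setP => x; apply/imsetP/idP => [[i _ ->]|xs]; first exact: (mP i).1.
have /dominantP/(_ x)[i iJ ux] := dsJ; exists i => //.
by rewrite (m_eq xs ux).
Qed.

(** Dominance applied to a point of [s] makes it minimal over [s] in a coordinate of [J], so taking
    minima maps [J] onto [s]. By counting, the map is bijective in a room and identifies exactly one
    pair of indices in a door. *)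
Lemma argmin_of_dominant : exists m : I -> X,
  [/\ m @: J = s, forall i, m i \in s,
    forall i x, x \in s -> u i (m i) <= u i x &
    forall i x, x \in s -> (forall y, y \in s -> u i x <= u i y) -> m i = x].
Proof. by exists m; split=> // i; [case: (mP i)|case: (mP i)]. Qed.

End Minimum.

(** Let [a] and [b] be the two indices with the same minimum, and let [k] be one of them. Dropping
    [k] keeps dominance if no point lies above all the other minima; otherwise, among the points of
    [M k] that do, the one highest in [u k] enters. These two moves are distinct and are the only
    ones. *)
Lemma card_edges_door d : good d -> d.1 != set0 -> #|[set r | edge d r]| = 2.
Proof.
case: d => s J gd /= /set0Pn[x1 x1s].
have /and3P[/andP[/= dsJ /eqP cJ] i0J _] := gd.
have [m [msurj ms mle meq]] := argmin_of_dominant x1s dsJ.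
have [a [b [aJ bJ ab mab]]] : exists a b, [/\ a \in J, b \in J, a != b & m a = m b].
  have : ~~ [forall a in J, forall b in J, (m a == m b) ==> (a == b)].
    apply/negP => /'forall_in_'forall_in_implyP minj.
    have : #|m @: J| = #|J|.
      by apply: card_in_imset => x y xJ yJ /eqP /(minj x xJ y yJ) /eqP.
    by rewrite msurj cJ => /eqP; rewrite -[_ == _]negbK neq_ltn ltnSn.
  case/forall_inPn => a aJ /forall_inPn [b bJ]; rewrite negb_imply => /andP[/eqP mab ab].
  by exists a, b.
have msurjD k l : k \in J -> l \in J -> k != l -> m k = m l -> m @: (J :\ k) = s.
  move=> kJ lJ kl mkl; apply/setP => x; rewrite -msurj; apply/imsetP/imsetP.
    by move=> [i /setD1P[_ iJ] ->]; exists i.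
  move=> [i iJ ->]; have [->|ik] := eqVneq i k.
    by exists l => //; rewrite !inE eq_sym kl.
  by exists i => //; rewrite !inE ik.
pose M k := [set y | [forall j in J :\ k, u j (m j) < u j y]].
have MP k y : reflect (forall j, j \in J -> j != k -> u j (m j) < u j y) (y \in M k).
  rewrite inE; apply: (iffP forall_inP) => H j.
    by move=> jJ jk; apply: H; rewrite !inE jk.
  by move=> /setD1P[jk jJ]; exact: H.
pose nb k : {set X} * {set I} :=
  if [pick y in M k] is Some y then ([arg max_(z > y in M k) u k z] |: s, J) else (s, J :\ k).
have MJ y : exists2 i, i \in J & u i y <= u i (m i).
  by have /dominantP/(_ y)[i iJ iu] := dsJ; exists i => //; exact: iu.
have ymax k l y : k \in J -> l \in J -> k != l -> m k = m l ->
    y \in M k -> (y \notin s) /\ u k y <= u k (m k).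
  move=> kJ lJ kl mkl /MP yM; split.
    apply/negP; rewrite -(msurjD k l kJ lJ kl mkl) => /imsetP[j /setD1P[jk jJ] yj].
    by have := yM j jJ jk; rewrite yj ltnNge mle.
  have [i iJ iu] := MJ y; have [<-//|ik] := eqVneq i k.
  by have := yM i iJ ik; rewrite ltnNge iu.
have nb_edge k l : k \in J -> l \in J -> k != l -> m k = m l -> edge (s, J) (nb k).
  move=> kJ lJ kl mkl; rewrite /edge gd /= /nb; case: pickP => [y yM|M0].
    case: arg_maxnP => // z zM zmax.
    have [zs uz] := ymax k l z kJ lJ kl mkl zM.
    rewrite /room /= cardsU1 zs cJ eqxx andbT; apply/andP; split; last first.
      by apply/orP; left; apply/existsP; exists z; rewrite zs eqxx.
    apply/dominantP => w; have [wM|] := boolP (w \in M k).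
      exists k => // x /setU1P[->|xs]; first exact: zmax.
      by apply: leq_trans (zmax _ wM) (leq_trans uz _); exact: mle.
    rewrite inE => /forall_inPn[j /setD1P[jk jJ]]; rewrite -leqNgt => wj.
    exists j => // x /setU1P[->|xs]; last exact: leq_trans wj (mle _ _ xs).
    by apply: leq_trans wj (ltnW _); move/MP: zM; exact.
  rewrite /room /=; apply/andP; split; last first.
    by apply/orP; right; apply/existsP; exists k; rewrite kJ eqxx.
  have := cardsD1 k J; rewrite kJ cJ add1n => -[<-]; rewrite eqxx andbT.
  apply/dominantP => w; have := M0 w; rewrite inE => /negbT /forall_inPn[j jJ].
  by rewrite -leqNgt => wj; exists j => // x xs; exact: leq_trans wj (mle _ _ xs).
have ba : b != a by rewrite eq_sym.
have nbab : nb a != nb b.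
  apply/eqP; rewrite /nb; case: pickP => [y yM|Ma]; case: pickP => [z zM|Mb].
  - case: arg_maxnP => // v vM _; case: arg_maxnP => // w wM _ [vw].
    have [vs _] := ymax a b v aJ bJ ab mab vM.
    have [ws _] := ymax b a w bJ aJ ba (esym mab) wM.
    have {vw} vw : v = w.
      have : v \in w |: s by rewrite -vw setU11.
      by move=> /setU1P[//|]; rewrite (negbTE vs).
    have [i iJ iu] := MJ v; have [ia|ia] := eqVneq i a.
      move/MP: wM => /(_ i iJ); rewrite ia => /(_ ab); rewrite -vw -ia.
      by rewrite ltnNge iu.
    by move/MP: vM => /(_ i iJ ia); rewrite ltnNge iu.
  - case: arg_maxnP => // v vM _ [_ Jb].
    by move: bJ; rewrite Jb setD11.
  - case: arg_maxnP => // v vM _ [_ Ja].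
    by move: aJ; rewrite -Ja setD11.
  - by move=> [] /setP /(_ a); rewrite !inE eqxx ab aJ.
rewrite (_ : [set r | _] = [set nb a; nb b]) ?cards2 ?nbab//.
apply/setP => r; rewrite !inE; apply/idP/orP; last first.
  by case=> /eqP ->; [exact: nb_edge aJ bJ ab mab|exact: nb_edge bJ aJ ba (esym mab)].
suff : edge (s, J) r -> exists2 k, k \in J & r = nb k /\ (k = a \/ k = b).
  by move=> H /H[k _ [-> [->|->]]]; [left|right].
case/and3P => _ /andP[dr /eqP cr] /orP[] /existsP[].
  move=> x /andP[/= xs /eqP rE]; rewrite {r}rE /= in dr cr *.
  (* The map of minima of the new room is injective and differs from [m] only at the index [k] whose
     minimum is the new point, so [k] has to be [a] or [b]. *)
  have [m' [m'surj m's m'le m'eq]] := argmin_of_dominant (setU11 x s) dr.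
  have m'inj : {in J &, injective m'} by apply/imset_injP; rewrite m'surj cr.
  have /imsetP[k kJ xk] : x \in m' @: J by rewrite m'surj setU11.
  have m'm j : j \in J -> j != k -> m' j = m j.
    move=> jJ jk; have /setU1P[jx|js] := m's j.
      by case/eqP: jk; apply: m'inj => //; rewrite jx.
    by apply/esym/meq => // y ys; apply: m'le; rewrite setU1r.
  have xM : x \in M k.
    apply/MP => j jJ jk; rewrite ltn_neqAle -m'm// m'le ?setU11// andbT.
    apply/eqP => /u_inj; rewrite xk => /m'inj jk'.
    by case/eqP: jk; exact: jk'.
  have kab : k = a \/ k = b.
    have [->|ka] := eqVneq k a; first by left.
    have [->|kb] := eqVneq k b; first by right.
    by case/eqP: ab; apply: m'inj => //; rewrite !m'm// eq_sym.
  exists k => //; split=> //; rewrite /nb; case: pickP => [y yM|/(_ x)]; last by rewrite xM.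
  case: arg_maxnP => // z zM zmax; congr (_ |: _, _).
  apply: (@u_inj k); apply/eqP; rewrite eqn_leq (zmax _ xM : u k x <= u k z) /=.
  have /dominantP/(_ z)[i iJ iu] := dr.
  have [<-|ik] := eqVneq i k; first by apply: iu; rewrite setU11.
  move/MP: zM => /(_ i iJ ik); rewrite ltnNge iu//.
  by rewrite setU1r.
move=> j /andP[/= jJ /eqP rE]; rewrite {r}rE /= in dr cr *.
have minj : {in J :\ j &, injective m}.
  apply/imset_injP; suff -> : m @: (J :\ j) = s by rewrite cr.
  apply/setP => x.
  apply/imsetP/idP => [[i _ ->]//|xs].
  have /dominantP/(_ x)[i iJ ux] := dr; exists i => //.
  by apply/esym/meq.
exists j => //; split; last first.
  have [->|ja] := eqVneq j a; first by left.
  have [->|jb] := eqVneq j b; first by right.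
  by case/eqP: ab; apply: minj => //; rewrite !inE eq_sym ?ja ?jb.
rewrite /nb; case: pickP => // y /MP yM.
have /dominantP/(_ y)[i /setD1P[ij iJ] iu] := dr.
by have := yM i iJ ij; rewrite ltnNge iu.
Qed.

(** Only the point highest in [u i0] can enter: dropping [i0] would leave an empty index set, which
    is never dominant. *)
Lemma card_edges_outer_door : #|[set r | edge (set0, [set i0]) r]| = 1.
Proof.
pose t := [arg max_(x > x0) u i0 x].
have tmax x : u i0 x <= u i0 t by rewrite /t; case: arg_maxnP => // i _; apply.
rewrite (_ : [set r | _] = [set ([set t], [set i0])]) ?cards1//.
apply/setP => -[s J]; rewrite !inE; apply/idP/eqP.
  case/and3P => _ /andP[/= ds /eqP cs] /orP[] /existsP[].
    move=> x /andP[_ /eqP[sE JE]]; rewrite sE JE setU0 in ds cs *.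
    congr (_, _); congr [set _]; apply: (@u_inj i0); apply/eqP.
    rewrite eqn_leq tmax /=.
    by have /dominantP/(_ t)[i /set1P ->] := ds; apply; rewrite set11.
  move=> j /andP[/= /set1P -> /eqP[sE JE]]; rewrite sE JE in ds.
  by have /dominantP/(_ x0)[i] := ds; rewrite !inE andNb.
move=> [-> ->]; apply/and3P; split.
- rewrite /good /door /= cards0 cards1 set11 imset0 setDv !eqxx !andbT.
  by apply/dominantP => y; exists i0; [rewrite set11|move=> x; rewrite inE].
- rewrite /room /= !cards1 eqxx andbT; apply/dominantP => y.
  by exists i0; [rewrite set11|move=> x /set1P ->].
- by apply/orP; left; apply/existsP; exists t; rewrite inE /= setU0.
Qed.

Lemma edges_of_room r : room r -> [set d | edge d r] =
  [set d | [exists x in r.1, (d == (r.1 :\ x, r.2)) && (i0 \in r.2) &&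
    (c @: (r.1 :\ x) == r.2 :\ i0)]] :|:
  [set d | [exists j in ~: r.2, (d == (r.1, j |: r.2)) && (i0 \in j |: r.2) &&
    (c @: r.1 == (j |: r.2) :\ i0)]].
Proof.
case: r => s J rr; have /andP[/= dr /eqP cr] := rr.
apply/setP => -[s' J']; rewrite !inE; apply/idP/orP.
  case/and3P => /and3P[/= dd i0J /eqP cJ] _ /orP[] /existsP[].
    move=> x /andP[xs /eqP[sE JE]]; left; apply/existsP; exists x.
    by rewrite sE JE setU11 setU1K// eqxx i0J cJ eqxx.
  move=> j /andP[jJ /eqP[sE JE]]; right; apply/existsP; exists j.
  by rewrite sE JE setD1K// i0J cJ !eqxx !inE eqxx.
case=> /existsP[].
  move=> x /andP[xs /andP[/andP[/eqP[-> ->] i0J] /eqP cJ]].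
  rewrite /edge rr /good /door /= i0J cJ eqxx !andbT; apply/andP; split.
    rewrite (dominantS (subD1set _ _) (subxx _) dr) /= -cr.
    by have := cardsD1 x s; rewrite xs add1n => ->.
  by apply/orP; left; apply/existsP; exists x; rewrite /= setD11 setD1K// eqxx.
move=> j /andP[jJ /andP[/andP[/eqP[-> ->] i0J] /eqP cJ]]; rewrite inE in jJ.
rewrite /edge rr /good /door /= i0J cJ eqxx !andbT; apply/andP; split.
  by rewrite (dominantS (subxx _) (subsetUr _ _) dr) /= cr cardsU1 jJ.
by apply/orP; right; apply/existsP; exists j; rewrite /= setU11 setU1K// eqxx.
Qed.

(** There is no good door or there are two. One good door singles out a point [x] with
    [c @: (s :\ x) = J :\ i0]. If [c x] lies in [J], it repeats the label of some [x'], whose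
    removal is the second door; otherwise adding the index [c x] is. *)
Lemma even_edges_of_room r : room r -> c @: r.1 != r.2 -> ~~ odd #|[set d | edge d r]|.
Proof.
case: r => s J rr nfin; have /andP[/= dr /eqP cr] := rr; rewrite /= in nfin.
have [->|/set0Pn[d0]] := eqVneq [set d | edge d (s, J)] set0; first by rewrite cards0.
rewrite edges_of_room// /= => d0E.
have [x [xs i0J cx]] : exists x, [/\ x \in s, i0 \in J & c @: (s :\ x) = J :\ i0].
  move: d0E; rewrite !inE => /orP[] /existsP[].
    by move=> x /andP[xs /andP[/andP[_ i0J] /eqP cJ]]; exists x.
  (* For a door that adds [j], the point to single out is the one labelled [j]. *)
  move=> j /andP[jJ /andP[/andP[_ i0J] /eqP cJ]]; rewrite inE in jJ.
  have ji0 : j != i0.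
    by apply: contraNneq nfin => ji; rewrite cJ ji setU1K// -ji.
  have {}i0J : i0 \in J by move: i0J => /setU1P[ij|//]; rewrite ij eqxx in ji0.
  have : j \in c @: s by rewrite cJ !inE ji0 eqxx.
  move=> /imsetP[x xs jx]; exists x; split=> //.
  have cinj : {in s &, injective c}.
    apply/imset_injP; rewrite cJ; have := cardsD1 i0 (j |: J).
    by rewrite cardsU1 jJ setU1r// -cr !add1n => -[->].
  apply/setP => i; apply/imsetP/setD1P.
    move=> [y /setD1P[yx ys] ->]; have : c y \in c @: s by rewrite imset_f.
    rewrite cJ => /setD1P[-> /setU1P[cy|->]]//; case/eqP: yx; apply: cinj => //.
    by rewrite cy jx.
  move=> [ii0 iJ]; have : i \in c @: s by rewrite cJ !inE ii0 iJ orbT.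
  move=> /imsetP[y ys iy]; exists y => //; rewrite !inE ys andbT.
  by apply: contraNneq jJ => yx; rewrite jx -yx -iy.
have cinj : {in s :\ x &, injective c}.
  apply/imset_injP; rewrite cx; have := cardsD1 i0 J; have := cardsD1 x s.
  by rewrite xs i0J cr !add1n => -> -[->].
have cxi0 : c x != i0.
  apply: contraNneq nfin => cxi; apply/eqP.
  by rewrite -(setD1K xs) imsetU1 cx cxi setD1K.
suff [d [d' [dd' ->]]] : exists d d' : {set X} * {set I}, d != d' /\
    ([set d | [exists x in s, (d == (s :\ x, J)) && (i0 \in J) &&
      (c @: (s :\ x) == J :\ i0)]] :|:
    [set d | [exists j in ~: J, (d == (s, j |: J)) && (i0 \in j |: J) &&
      (c @: s == (j |: J) :\ i0)]]) =
    [set d; d'].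
  by rewrite cards2 dd'.
have [cxJ|cxJ] := boolP (c x \in J).
  have : c x \in c @: (s :\ x) by rewrite cx !inE cxi0.
  move=> /imsetP[x' /setD1P[x'x x's] cx'].
  have cs : c @: s = J :\ i0.
    rewrite -(setD1K xs) imsetU1 cx setUC; apply/setUidPl.
    by rewrite sub1set !inE cxi0.
  exists (s :\ x, J), (s :\ x', J); split.
    by apply/eqP => -[] /setP /(_ x); rewrite !inE eqxx xs eq_sym (negbTE x'x).
  have cx'E : c @: (s :\ x') = J :\ i0.
    rewrite -cs; apply/setP => i; apply/imsetP/imsetP => [[y /setD1P[_ ys] ->]|].
      by exists y.
    move=> [y ys ->]; have [->|yx'] := eqVneq y x'.
      by exists x => //; rewrite !inE eq_sym x'x.
    by exists y => //; rewrite !inE yx'.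
  apply/setP => d; rewrite !inE; apply/orP/orP; last first.
    case=> /eqP ->; left; apply/existsP; [exists x|exists x'].
      by rewrite xs eqxx i0J cx eqxx.
    by rewrite x's eqxx i0J cx'E eqxx.
  case=> /existsP[].
    move=> y /andP[ys /andP[/andP[/eqP -> _] /eqP cy]].
    have [->|yx] := eqVneq y x; first by left.
    have [->|yx'] := eqVneq y x'; first by right.
    have : c y \in c @: (s :\ y) by rewrite cy -cs imset_f.
    move=> /imsetP[z /setD1P[zy zs] cyz]; have [zx|zx] := eqVneq z x.
      case/eqP: yx'; apply: cinj; rewrite ?inE ?yx ?x'x// cyz zx.
      exact: cx'.
    by case/eqP: zy; apply: cinj; rewrite ?inE ?zx ?yx.
  move=> j; rewrite inE => /andP[jJ /andP[_ /eqP]]; rewrite cs => /setP /(_ j).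
  by rewrite !inE eqxx (negbTE jJ) /= andbF andbT => /esym/negbFE/eqP ji; rewrite ji i0J in jJ.
exists (s :\ x, J), (s, c x |: J); split.
  by apply/eqP => -[] /setP /(_ x); rewrite !inE eqxx xs.
have cs : c @: s = (c x |: J) :\ i0.
  rewrite -{1}(setD1K xs) imsetU1 cx; apply/setP => i; rewrite !inE.
  by have [->|] := eqVneq i (c x); rewrite ?cxi0.
apply/setP => d; rewrite !inE; apply/orP/orP; last first.
  case=> /eqP ->; [left|right]; apply/existsP; [exists x|exists (c x)].
    by rewrite xs eqxx i0J cx eqxx.
  by rewrite inE cxJ eqxx cs eqxx setU1r.
case=> /existsP[].
  move=> y /andP[ys /andP[/andP[/eqP -> _] /eqP cy]].
  have [->|yx] := eqVneq y x; first by left.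
  have : c x \in c @: (s :\ y) by rewrite imset_f// !inE eq_sym yx.
  by rewrite cy !inE (negbTE cxJ) andbF.
move=> j; rewrite inE => /andP[jJ /andP[/andP[/eqP -> _] /eqP cj]]; right.
have : c x \in c @: s by rewrite imset_f.
by rewrite cj !inE (negbTE cxJ) orbF => /andP[_ /eqP ->].
Qed.

(* Scarf's parity argument on the edges: a full room has one good door, any other room
   an even number; a good door leads to two rooms, except the outer one. *)
Theorem dominant_full_labelling :
  exists (s : {set X}) (J : {set I}), [/\ dominant s J, c @: s = J & J != set0].
Proof.
have [/existsP[[s J] /andP[/andP[/= dr /eqP cr] /eqP cs]]|nfin] :=
    boolP [exists r, room r && (c @: r.1 == r.2)].
  exists s, J; split=> //; have /dominantP/(_ x0)[i iJ _] := dr.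
  by apply/set0Pn; exists i.
have swap : \sum_d #|[set r | edge d r]| = \sum_r #|[set d | edge d r]|.
  under eq_bigr do rewrite -sum1dep_card big_mkcond.
  by rewrite exchange_big; under [RHS]eq_bigr do rewrite -sum1dep_card big_mkcond.
have : odd (\sum_r #|[set d | edge d r]|) = false.
  apply/negbTE; elim/big_ind : _ => // [a b|r _]; first by rewrite oddD => /negbTE -> /negbTE ->.
  have [rr|nr] := boolP (room r); last first.
    rewrite (_ : [set d | _] = set0) ?cards0//; apply/setP => d.
    by rewrite !inE /edge (negbTE nr) andbF.
  apply: even_edges_of_room => //.
  by move/existsPn: nfin => /(_ r); rewrite rr.
rewrite -swap (bigD1 (set0, [set i0])) //= card_edges_outer_door oddD.
suff /negbTE -> : ~~ odd (\sum_(d | d != (set0, [set i0])) #|[set r | edge d r]|) by [].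
elim/big_ind : _ => // [a b|[s J] dn]; first by rewrite oddD => /negbTE -> /negbTE ->.
have [gd|ng] := boolP (good (s, J)); last first.
  rewrite (_ : [set r | _] = set0) ?cards0//; apply/setP => r.
  by rewrite !inE /edge (negbTE ng).
rewrite card_edges_door//=; apply: contraNneq dn => s0.
have /and3P[_ /= i0J] := gd; rewrite s0 imset0 => /eqP J0.
by rewrite -(setD1K i0J) -J0 setU0.
Qed.

End DominantPairs.

(** * Labellings of the grid points of a simplex *)

Section GridLabelling.
Variables (I : finType) (i0 : I) (N : nat).

(* In a dominant pair [(s, J)] of grid points, ordered by each coordinate, the
   minima [m i] over [s] satisfy [\sum_(i in J) (m i).+1 > N], so that [s] lies
   within [#|I|] of [w], which is [m] on [J] with the defect added at [j0]. *)
Lemma grid_labelling (c : {ffun I -> 'I_N.+1} -> I) :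
  exists (w : I -> nat) (J : {set I}) (j0 : I),
    [/\ j0 \in J, \sum_i w i = N, forall i, i \notin J -> w i = 0 &
      forall i, i \in J -> exists a : {ffun I -> 'I_N.+1},
        [/\ c a = i, \sum_k a k = N, forall k, k != j0 -> w k <= a k &
          w j0 <= a j0 + #|I|]].
Proof.
pose X : finType := {a : {ffun I -> 'I_N.+1} | \sum_i a i == N}.
have mkX (w : I -> nat) : \sum_i w i = N -> exists a : X, forall i, val a i = w i :> nat.
  move=> wN; have wle i : w i < N.+1.
    by rewrite ltnS -wN (bigD1 i)//= leq_addr.
  have aN : \sum_i [ffun i => Ordinal (wle i)] i == N.
    by apply/eqP; rewrite -[RHS]wN; apply: eq_bigr => i _; rewrite ffunE.
  by exists (exist (fun a : {ffun I -> 'I_N.+1} => \sum_i a i == N) _ aN) => i; rewrite /= ffunE.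
have [x0 _] : exists a : X, forall i, val a i = (if i == i0 then N else 0) :> nat.
  by apply: mkX; rewrite -big_mkcond big_pred1_eq.
(* Ties in a coordinate are broken by the enumeration of [X], which makes each ranking injective. *)
pose u i (a : X) := val a i * #|X| + enum_rank a.
have rk (a : X) : enum_rank a < #|X| by exact: ltn_ord.
have u_lt i (a b : X) : val a i < val b i -> u i a < u i b.
  move=> ab; rewrite /u; apply: (@leq_trans ((val a i).+1 * #|X|)).
    by rewrite mulSn addnC ltn_add2r.
  by apply: leq_trans (leq_addr _ _); rewrite leq_mul2r ab orbT.
have u_inj i : injective (u i).
  move=> a b uab; apply: enum_rank_inj; apply: val_inj => /=.
  have ab : val a i = val b i.
    apply: val_inj => /=; apply/eqP; rewrite eqn_leq; apply/andP; split.
      by rewrite leqNgt; apply/negP => /u_lt; rewrite uab ltnn.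
    by rewrite leqNgt; apply/negP => /u_lt; rewrite uab ltnn.
  by move: uab; rewrite /u ab => /addnI.
have [s [J [dsJ cJ /set0Pn[j0 j0J]]]] :=
  @dominant_full_labelling X I u u_inj x0 i0 (fun a => c (val a)).
have /imsetP[a0 a0s _] : j0 \in [set c (val x) | x in s] by rewrite cJ.
pose m i := val (val [arg min_(a < a0 in s) val a i] i).
have mP i : (exists2 a, a \in s & m i = val a i) /\ forall a, a \in s -> m i <= val a i.
  by rewrite /m; case: arg_minnP => // a as_ amin; split; [exists a|].
(* Otherwise some grid point would exceed [m i] for every [i] in [J], the surplus being placed at
   [j0]; this contradicts dominance. *)
have mJ : N < \sum_(i in J) (m i).+1.
  rewrite ltnNge; apply/negP => le.
  pose w i := (if i \in J then (m i).+1 else 0) +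
    (if i == j0 then N - \sum_(i in J) (m i).+1 else 0).
  have [|y yw] := mkX w.
    by rewrite big_split /= -!big_mkcond big_pred1_eq subnKC.
  have /dominantP/(_ y)[i iJ iu] := dsJ.
  have [[a as_ mi] _] := mP i.
  have := iu _ as_; rewrite leqNgt => /negP; apply; apply: u_lt.
  by rewrite yw /w iJ -mi leq_addr.
have sum1 : \sum_(i in J) (m i).+1 = \sum_(i in J) m i + #|J|.
  by rewrite -sum1_card -big_split /=; apply: eq_bigr => i _; rewrite addn1.
have mN : \sum_(i in J) m i <= N.
  rewrite -(eqP (valP a0)) [X in _ <= X](bigID [in J]) /=.
  apply: leq_trans (leq_addr _ _); apply: leq_sum => i _.
  by have [_] := mP i; apply.
pose r := N - \sum_(i in J) m i.
have rI : r <= #|I|.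
  rewrite /r leq_subLR; apply: leq_trans (ltnW mJ) _.
  by rewrite sum1 leq_add2l max_card.
exists (fun i => (if i \in J then m i else 0) + (if i == j0 then r else 0)), J, j0.
split=> //.
- by rewrite big_split /= -!big_mkcond big_pred1_eq subnKC.
- move=> i iJ; rewrite (negbTE iJ) add0n; case: eqP => // ij.
  by rewrite ij j0J in iJ.
move=> i; rewrite -cJ => /imsetP[a as_ ia]; exists (val a); split=> //.
- exact/eqP/(valP a).
- move=> k kj; rewrite (negbTE kj) addn0; case: ifP => // _.
  by have [_] := mP k; apply.
- by rewrite cJ j0J eqxx leq_add//; have [_] := mP j0; apply.
Qed.

End GridLabelling.

From mathcomp Require Import all_classical all_reals all_analysis.
From mathcomp Require Import ring lra.
Import Order.TTheory GRing.Theory Num.Theory.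
Import numFieldNormedType.Exports.
Local Open Scope classical_set_scope.
Local Open Scope ring_scope.

(** * Hahn-Banach and convexity *)

Section HahnBanach.
Context {R : realType} {V : lmodType R}.
Implicit Types p q f : V -> R.

Definition sublinear p :=
  (forall x y, p (x + y) <= p x + p y) /\
  (forall t x, 0 < t -> p (t *: x) <= t * p x).

Lemma sublinearZ p t x : sublinear p -> 0 < t -> p (t *: x) = t * p x.
Proof.
move=> [_ pZ] t0; apply/eqP; rewrite eq_le pZ//= -ler_pdivlMl//.
by rewrite -{1}[x](scalerK (lt0r_neq0 t0)) pZ// invr_gt0.
Qed.

Lemma sublinear0 p : sublinear p -> p 0 = 0.
Proof.
move=> sp; have := @sublinearZ p 2 0 sp ltac:(by []); rewrite scaler0; lra.
Qed.

Lemma sublinearN p x : sublinear p -> - p (- x) <= p x.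
Proof.
move=> sp; have := sp.1 x (- x); rewrite subrr sublinear0//; lra.
Qed.

Definition cone (T : set (V * R)) :=
  [/\ T (0, 0),
      forall u s v r, T (u, s) -> T (v, r) -> T (u + v, s + r) &
      forall t u s, 0 < t -> T (u, s) -> T (t *: u, t * s)].

(* The greatest sublinear functional below [p] that forces [f u >= s] on [T]. *)
Definition cone_inf p (T : set (V * R)) (x : V) : R :=
  inf [set p (x + us.1) - us.2 | us in T].

Lemma cone_inf_has_inf p T x : sublinear p -> cone T ->
  (forall u s, T (u, s) -> s <= p u) ->
  has_inf [set p (x + us.1) - us.2 | us in T].
Proof.
move=> sp [T0 _ _] Tp; split; first by exists (p (x + 0) - 0), (0, 0).
exists (- p (- x)) => _ [[u s] Tus <-] /=.
have := Tp _ _ Tus; have := sp.1 (x + u) (- x); rewrite addrC addKr; lra.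
Qed.

Lemma cone_infP p T x u s : sublinear p -> cone T ->
  (forall u s, T (u, s) -> s <= p u) -> T (u, s) ->
  cone_inf p T x <= p (x + u) - s.
Proof.
move=> sp cT Tp Tus; apply: ge_inf; last by exists (u, s).
exact: (cone_inf_has_inf x sp cT Tp).2.
Qed.

Lemma cone_inf_sublinear p T : sublinear p -> cone T ->
  (forall u s, T (u, s) -> s <= p u) -> sublinear (cone_inf p T).
Proof.
move=> sp cT Tp; have [T0 TD TZ] := cT; split=> [x y|t x t0].
- apply/ler_addgt0Pr => e e0.
  have e20 : 0 < e / 2 by rewrite divr_gt0.
  have [_ [[u s] Tus <-] /= us] :=
    inf_adherent e20 (cone_inf_has_inf x sp cT Tp).
  have [_ [[v r] Tvr <-] /= vr] :=
    inf_adherent e20 (cone_inf_has_inf y sp cT Tp).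
  have := cone_infP (x + y) sp cT Tp (TD _ _ _ _ Tus Tvr).
  have := sp.1 (x + u) (y + v); rewrite addrACA -/(cone_inf p T x).
  rewrite -/(cone_inf p T x) in us; rewrite -/(cone_inf p T y) in vr; lra.
- rewrite -ler_pdivrMl//; apply: lb_le_inf.
    exact: (cone_inf_has_inf x sp cT Tp).1.
  move=> _ [[u s] Tus <-] /=; rewrite ler_pdivrMl//.
  apply: le_trans (cone_infP _ sp cT Tp (TZ _ _ _ t0 Tus)) _.
  by rewrite -scalerDr sublinearZ// mulrBr.
Qed.

Lemma cone_inf_le p T x : sublinear p -> cone T ->
  (forall u s, T (u, s) -> s <= p u) -> cone_inf p T x <= p x.
Proof.
move=> sp cT Tp; have [T0 _ _] := cT.
by have := cone_infP x sp cT Tp T0; rewrite addr0 subr0.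
Qed.

(** Minimality is tested against [cone_inf q] for the ray through [(y, q y)]: its value at [- y] is
    at most [- q y]. Hence [q] is odd, and an odd sublinear functional is linear. *)
Lemma minimal_sublinear_linear q : sublinear q ->
  (forall r, sublinear r -> (forall x, r x <= q x) -> r = q) -> linear (q : V -> R^o).
Proof.
move=> sq qmin.
have qN y : q (- y) = - q y.
  apply/eqP; rewrite eq_le; apply/andP; split; last first.
    by have := sublinearN (- y) sq; rewrite opprK.
  pose T := [set us : V * R | exists2 t, 0 <= t & us = (t *: y, t * q y)].
  have cT : cone T.
    split; first by exists 0; rewrite // scale0r mul0r.
      move=> u s v r [a a0 [-> ->]] [b b0 [-> ->]].
      by exists (a + b); rewrite ?addr_ge0// scalerDl mulrDl.
    move=> t u s t0 [a a0 [-> ->]].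
    by exists (t * a); rewrite ?mulr_ge0// ?ltW// scalerA mulrA.
  have Tq u s : T (u, s) -> s <= q u.
    case=> t; rewrite le_eqVlt => /orP[/eqP <-|t0] [-> ->].
      by rewrite scale0r mul0r sublinear0.
    by rewrite sublinearZ.
  rewrite -{1}(qmin _ (cone_inf_sublinear sq cT Tq)); last first.
    by move=> x; exact: cone_inf_le.
  have Ty : T (y, q y) by exists 1; rewrite ?ler01// scale1r mul1r.
  have := cone_infP (- y) sq cT Tq Ty.
  by rewrite addNr sublinear0// sub0r.
have qD x y : q (x + y) = q x + q y.
  apply/eqP; rewrite eq_le sq.1/=.
  have := sq.1 (x + y) (- y); rewrite addrK qN; lra.
move=> a x y; rewrite qD; congr (_ + _).
have [a0|a0|->] := ltgtP a 0.
- rewrite -[a in LHS]opprK scaleNr qN sublinearZ ?oppr_gt0//.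
  by rewrite mulNr opprK.
- exact: sublinearZ.
- by rewrite !scale0r sublinear0.
Qed.

(** Zorn's lemma, ordered downwards. Subadditivity passes to the infimum of a chain: of two members
    close to the infimum at [x] and at [y], the smaller one serves both. *)
Lemma linear_below_sublinear p : sublinear p ->
  exists2 f, linear (f : V -> R^o) & forall x, f x <= p x.
Proof.
move=> sp.
pose T := {q : V -> R | sublinear q /\ forall x, q x <= p x}.
pose ord (s t : T) := `[< forall x, sval t x <= sval s x >].
have [||||[q [sq qp]] qmin] := @Zorn T ord.
- by move=> t; apply/asboolP.
- by move=> r s t /asboolP rs /asboolP st; apply/asboolP => x; apply: le_trans (rs x).
- move=> [r rP] [s sP] /asboolP rs /asboolP sr; apply: eq_exist => /=.
  by apply/funext => x; apply/eqP; rewrite eq_le sr rs.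
- move=> A Atot; have [[t0 At0]|A0] := pselect (A !=set0); last first.
    by exists (exist _ p (conj sp (fun x => lexx _))) => s As; case: A0; exists s.
  pose g x := inf [set sval t x | t in A].
  have hi x : has_inf [set sval t x | t in A].
    split; first by exists (sval t0 x), t0.
    exists (- p (- x)) => _ [[t [st tp]] At <-] /=.
    by have := sublinearN x st; have := tp (- x); lra.
  have gle t x : A t -> g x <= sval t x.
    by move=> At; apply: ge_inf; [exact: (hi x).2|exists t].
  have sg : sublinear g.
    split=> [x y|t x t0'].
      apply/ler_addgt0Pr => e e0; have e20 : 0 < e / 2 by rewrite divr_gt0.
      have [_ [s As <-] sx] := inf_adherent e20 (hi x).
      have [_ [t At <-] ty] := inf_adherent e20 (hi y).
      rewrite -/(g x) in sx; rewrite -/(g y) in ty.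
      have [/asboolP st|/asboolP ts] := Atot _ _ As At.
        have := gle _ (x + y) At; have := (svalP t).1.1 x y; have := st x; lra.
      have := gle _ (x + y) As; have := (svalP s).1.1 x y; have := ts y; lra.
    rewrite -ler_pdivrMl//; apply: lb_le_inf; first exact: (hi x).1.
    move=> _ [s As <-]; rewrite ler_pdivrMl//.
    exact: le_trans (gle _ _ As) ((svalP s).1.2 _ _ t0').
  have gp x : g x <= p x by apply: le_trans (gle _ x At0) _; exact: (svalP t0).2.
  by exists (exist _ g (conj sg gp)) => s As; apply/asboolP => x; exact: gle.
- exists q => //; apply: minimal_sublinear_linear => // r sr rq.
  have rp x : r x <= p x by exact: le_trans (qp x).
  have /(congr1 sval) : exist _ r (conj sr rp) = exist _ q (conj sq qp) :> T.
    by apply: qmin; apply/asboolP.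
  by [].
Qed.

(** A linear functional below [cone_inf p T] serves: the pair [(u, s)] bounds its value at [- u] by
    [p 0 - s = - s]. *)
Theorem mazur_orlicz p T : sublinear p -> cone T ->
  (forall u s, T (u, s) -> s <= p u) ->
  exists f, [/\ linear (f : V -> R^o), forall x, f x <= p x &
    forall u s, T (u, s) -> s <= f u].
Proof.
move=> sp cT Tp.
have [f lf fp] := linear_below_sublinear (cone_inf_sublinear sp cT Tp).
have fN u : f (- u) = - f u.
  have := lf (-1) u 0; rewrite addr0 scaleN1r => ->.
  have := lf 1 0 0; rewrite scaler0 addr0 scale1r => f0.
  have {f0} : f 0 = 0 by lra.
  by move=> ->; rewrite addr0 scaleN1r.
exists f; split=> // [x|u s Tus]; first exact: le_trans (fp x) (cone_inf_le x sp cT Tp).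
have := fp (- u); have := cone_infP (- u) sp cT Tp Tus.
by rewrite addNr sublinear0// fN; lra.
Qed.

End HahnBanach.

Section Convexity.
Context {R : realType} {V : lmodType R}.
Implicit Types A C : set V.

Definition cvx C := forall t x y, 0 <= t -> t <= 1 -> C x -> C y ->
  C (t *: x + (1 - t) *: y).

(** Taken as an intersection, so that a property of all convex combinations is proved by exhibiting
    a convex set that contains [A]. *)
Definition hull A : set V := [set x | forall C, cvx C -> A `<=` C -> C x].

Lemma hull_cvx A : cvx (hull A).
Proof.
move=> t x y t0 t1 hx hy C cC AC.
exact: (cC _ _ _ t0 t1 (hx _ cC AC) (hy _ cC AC)).
Qed.

Lemma sub_hull A : A `<=` hull A.
Proof. by move=> x Ax C _; apply. Qed.

Lemma hull_min A C : cvx C -> A `<=` C -> hull A `<=` C.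
Proof. by move=> cC AC x; apply. Qed.

Lemma hullS A B : A `<=` B -> hull A `<=` hull B.
Proof.
by move=> AB; apply: hull_min; [exact: hull_cvx|exact: subset_trans (@sub_hull _)].
Qed.

Lemma hull_half A x y : hull A x -> hull A y -> hull A (2^-1 *: (x + y)).
Proof.
move=> hx hy; have -> : 2^-1 *: (x + y) = 2^-1 *: x + (1 - 2^-1) *: y.
  by rewrite scalerDr; congr (_ + _ *: _); lra.
by apply: hull_cvx => //; lra.
Qed.

End Convexity.

(** * Functionals and the weak topology *)

Section WeakTopology.
Context {R : realType} {E : normedModType R}.
Implicit Types (f g : E -> R) (k : R).

(** Functionals are bare functions with an explicit norm bound, so that pointwise limits and convex
    combinations of them need no bundling. *)
Definition blin k f :=
  (forall a x y, f (a *: x + y) = a * f x + f y) /\ forall x, `|f x| <= k * `|x|.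

Lemma linear_of f : linear (f : E -> R^o) -> exists L : {linear E -> R^o}, L = f :> (E -> R).
Proof.
move=> lf.
pose m := GRing.isLinear.Build R E R^o *:%R f lf.
pose L : {linear E -> R^o} := HB.pack f m.
by exists L.
Qed.

Lemma linear_dual (L : {linear E -> R^o}) k : (forall x, `|L x| <= k * `|x|) -> continuous L.
Proof.
move=> Lk; apply/linear_bounded_continuous/linear_boundedP.
near=> r => x; apply: le_trans (Lk x) _; rewrite ler_wpM2r //.
Unshelve. all: by end_near. Qed.

Lemma dual_blin (d : dual E) : exists2 k, 0 < k & blin k (sval d).
Proof.
case: d => L cL /=.
have /linear_boundedP/pinfty_ex_gt0 [k k0 Lk] := continuous_linear_bounded 0 (cL 0).
by exists k => //; split => // a x y; exact: linearP.
Qed.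

Lemma weak_cvgP (F : set_system (weak E)) (l : E) : Filter F ->
  F --> (l : weak E) <-> forall k f, blin k f -> f @ F --> f l.
Proof.
move=> FF; rewrite /weak; split=> [Fl k f [lf fk]|Fl].
  have [L Lf] := linear_of lf.
  have cL : continuous L by apply: (@linear_dual _ k) => x; rewrite Lf.
  have /(cvg_sup _ _ FF)/(_ (exist _ L cL)) Fi := Fl.
  rewrite -Lf; apply: cvg_trans (@initial_continuous E R^o L l).
  exact: cvg_app.
apply/(cvg_sup _ _ FF) => d A [_ [[B oB <-] Bl] BA].
have [k k0 bd] := dual_blin d.
have FB : F (sval d @^-1` B) by apply: (Fl _ _ bd); exact: open_nbhs_nbhs.
exact: filterS FB.
Qed.

Section BlinTheory.
Variables (k : R) (f : E -> R).
Hypothesis bf : blin k f.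

Lemma blin_lin a x y : f (a *: x + y) = a * f x + f y. Proof. exact: bf.1. Qed.
Lemma blinD x y : f (x + y) = f x + f y.
Proof. by rewrite -{1}[x]scale1r blin_lin mul1r. Qed.
Lemma blin0 : f 0 = 0.
Proof. by have := blinD 0 0; rewrite addr0; lra. Qed.
Lemma blinZ a x : f (a *: x) = a * f x.
Proof. by rewrite -[a *: x]addr0 blin_lin blin0 addr0. Qed.
Lemma blinN x : f (- x) = - f x.
Proof. by rewrite -scaleN1r blinZ mulN1r. Qed.
Lemma blinB x y : f (x - y) = f x - f y.
Proof. by rewrite blinD blinN. Qed.
Lemma blin_bound x : `|f x| <= k * `|x|. Proof. exact: bf.2. Qed.
End BlinTheory.

Lemma blin_le k k' f : k <= k' -> blin k f -> blin k' f.
Proof.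
by move=> kk' [lf fk]; split=> // x; apply: le_trans (fk x) _; rewrite ler_wpM2r.
Qed.

Lemma blin_cst0 : blin 1 (fun=> 0).
Proof. by split=> [*|x]; rewrite ?mulr0 ?addr0// normr0 mul1r. Qed.

Lemma blin_scale k a f : blin k f -> blin (`|a| * k) (fun x => a * f x).
Proof.
move=> bf; split=> [b x y|x]; first by rewrite (blin_lin bf) mulrDr mulrCA.
by rewrite normrM -mulrA ler_wpM2l// (blin_bound bf).
Qed.

Lemma blin_add k k' f g : blin k f -> blin k' g -> blin (k + k') (fun x => f x + g x).
Proof.
move=> bf bg; split=> [b x y|x].
  by rewrite (blin_lin bf) (blin_lin bg) mulrDr addrACA.
apply: le_trans (ler_normD _ _) _.
by rewrite mulrDl lerD// ?(blin_bound bf)// (blin_bound bg).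
Qed.

Lemma blin_opp k f : blin k f -> blin k (fun x => - f x).
Proof.
move=> bf; split=> [b x y|x].
  by rewrite (blin_lin bf) opprD mulrN.
by rewrite normrN (blin_bound bf).
Qed.

Lemma blin_sub k k' f g : blin k f -> blin k' g -> blin (k + k') (fun x => f x - g x).
Proof. by move=> bf /blin_opp; exact: blin_add. Qed.

Lemma blin_lim k (I : Type) (F : set_system I) (u : I -> E -> R) (f : E -> R) :
  ProperFilter F -> (forall i, blin k (u i)) ->
  (forall x, u i x @[i --> F] --> f x) -> blin k f.
Proof.
move=> FF bu uf; split=> [a x y|x].
  have c1 : a * u i x + u i y @[i --> F] --> a * f x + f y.
    by apply: cvgD (uf y); apply: cvgMr (uf x).
  have c2 := uf (a *: x + y).
  have e : (fun i => u i (a *: x + y)) = (fun i => a * u i x + u i y).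
    by apply/funext => i; rewrite (blin_lin (bu i)).
  by rewrite e in c2; exact: (cvg_unique (@norm_hausdorff _ R^o) c2 c1).
apply: (cvgr_to_le (cvg_norm (uf x))).
by near=> i; exact: blin_bound.
Unshelve. all: by end_near. Qed.

Lemma norm_sublinear : sublinear (fun x : E => `|x|).
Proof.
by split=> [x y|t x t0]; [exact: ler_normD|rewrite normrZ gtr0_norm].
Qed.

Lemma below_norm f : (forall a x y, f (a *: x + y) = a * f x + f y) ->
  (forall x, f x <= `|x|) -> blin 1 f.
Proof.
move=> lf fp; split=> // x; rewrite mul1r ler_norml fp andbT lerNl.
have <- : f (- x) = - f x.
  have f0 : f 0 = 0 by have := lf 1 0 0; rewrite scaler0 addr0; lra.
  by have := lf (-1) x 0; rewrite f0 !addr0 scaleN1r mulN1r.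
by rewrite -normrN.
Qed.

Lemma convex_set_cvx (C : set E) : convex_set C -> cvx C.
Proof.
move=> cC t x y t0 t1 Cx Cy.
have t01 : t \in `[0%R, 1%R] by rewrite in_itv/= t0 t1.
by have /set_mem := cC x y (Itv01 t0 t1) (mem_set Cx) (mem_set Cy).
Qed.

(** The Mazur-Orlicz theorem for the norm and the cone spanned by the pairs [(x - y, r)] with [y] in
    [C]; convexity of [C] closes it under sums. *)
Lemma separation (C : set E) x r : cvx C -> (forall y, C y -> r <= `|x - y|) ->
  exists2 f, blin 1 f & forall y, C y -> f y + r <= f x.
Proof.
move=> cC Cr.
pose T := [set us : E * R | us = (0, 0) \/
  exists t y, [/\ 0 < t, C y & us = (t *: (x - y), t * r)]].
have cT : cone T.
  split; first by left.
    move=> u s v q [[-> ->]|[a [y [a0 Cy [-> ->]]]]]; first by rewrite !add0r.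
    case=> [[-> ->]|[b [z [b0 Cz [-> ->]]]]].
      by rewrite !addr0; right; exists a, y.
    right; exists (a + b), ((a / (a + b)) *: y + (1 - a / (a + b)) *: z).
    have ab0 : 0 < a + b by rewrite addr_gt0.
    split=> //.
      apply: cC => //; first by rewrite divr_ge0 ?ltW.
      by rewrite ler_pdivrMr// mul1r lerDl ltW.
    rewrite -mulrDl; congr pair.
    rewrite [RHS]scalerBr [X in _ = _ - X]scalerDr !scalerA mulrBr mulr1.
    rewrite [(a + b) * _]mulrC divfK ?gt_eqF// [a + b - a]addrAC subrr add0r.
    by rewrite !scalerBr scalerDl opprD addrACA.
  move=> t u s t0 [[-> ->]|[a [y [a0 Cy [-> ->]]]]].
    by left; rewrite scaler0 mulr0.
  by right; exists (t * a), y; rewrite mulr_gt0// scalerA mulrA.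
have Tp u s : T (u, s) -> s <= `|u|.
  move=> [[-> ->]|[a [y [a0 Cy [-> ->]]]]]; first by rewrite normr0.
  by rewrite normrZ gtr0_norm// ler_pM2l// Cr.
have [f [lf fp fT]] := mazur_orlicz norm_sublinear cT Tp.
have bf := below_norm lf fp.
exists f => // y Cy.
have := fT (x - y) r; rewrite (blinB bf) => H.
suff : r <= f x - f y by lra.
by apply: H; right; exists 1, y; rewrite ltr01 scale1r mul1r.
Qed.

Lemma norming x : exists2 f, blin 1 f & f x = `|x|.
Proof.
have [||f bf /(_ 0 erefl)] := @separation [set 0] x `|x|.
- by move=> t u v _ _ -> ->; rewrite !scaler0 addr0.
- by move=> _ ->; rewrite subr0.
rewrite (blin0 bf) add0r => fx; exists f => //; apply/eqP; rewrite eq_le fx andbT.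
by have := blin_bound bf x; rewrite mul1r; apply: le_trans; exact: ler_norm.
Qed.

Lemma blin_separates x y : (forall f, blin 1 f -> f x = f y) -> x = y.
Proof.
move=> H; have [f bf fxy] := norming (x - y); apply/eqP.
by rewrite -subr_eq0 -normr_eq0 -fxy (blinB bf) H// subrr.
Qed.

Lemma weak_cvg1P (F : set_system (weak E)) (l : E) : Filter F ->
  F --> (l : weak E) <-> forall f, blin 1 f -> f @ F --> f l.
Proof.
move=> FF; rewrite weak_cvgP; split=> [Fl f|Fl k f bf]; first exact: Fl.
pose m : R := `|k| + 1.
have m0 : 0 < m by rewrite ltr_wpDl.
have bg : blin 1 (fun x => m^-1 * f x).
  apply: blin_le (blin_scale m^-1 bf).
  rewrite normfV gtr0_norm// ler_pdivrMl// mulr1.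
  by apply: le_trans (ler_norm _) _; rewrite lerDl.
have -> : f = (fun x => m * (m^-1 * f x)).
  by apply/funext => x; rewrite mulVKf// gt_eqF.
by apply: cvgMr; exact: Fl bg.
Qed.

(** If [C] stayed at distance [r] from [x], a separating functional would remain at least [r] below
    [f x] on [C], against weak convergence. *)
Lemma mazur (C : set E) (F : set_system (weak E)) (x : E) r : ProperFilter F ->
  cvx C -> F C -> F --> (x : weak E) -> 0 < r -> exists2 y, C y & `|x - y| < r.
Proof.
move=> FF cC FC Fx r0; apply: contrapT => nC.
have [||f bf fC] := @separation C x r => //.
  by move=> y Cy; rewrite leNgt; apply/negP => xy; apply: nC; exists y.
have /(weak_cvg1P _ _)/(_ _ bf) fx := Fx.
have : f x <= f x - r.
  apply: (cvgr_to_le fx); apply: filterS FC => y /fC; lra.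
lra.
Qed.

Lemma closed_cvx_weak_lim (C : set E) (F : set_system (weak E)) (x : E) :
  ProperFilter F -> closed C -> cvx C -> F C -> F --> (x : weak E) -> C x.
Proof.
move=> FF clC cC FC Fx; apply: clC => B /nbhs_normP [r r0 rB].
by have [y Cy xy] := mazur FF cC FC Fx r0; exists y; split=> //; exact: rB.
Qed.

End WeakTopology.

(** * Eberlein sequences *)

Section Subsequences.

(** Dependent choice with access to the whole history. A next term is demanded only after a prefix
    built by the same rule, so [Q] serves as an invariant. *)
Lemma sequence_by_prefix (T : Type) (Q : seq T -> T -> Prop) (t0 : T) :
  (forall s, (forall i, (i < size s)%N -> Q (take i s) (nth t0 s i)) ->
    exists t, Q s t) ->
  exists p : nat -> T, forall n, Q (mkseq p n) (p n).
Proof.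
move=> H.
pose valid s := forall i, (i < size s)%N -> Q (take i s) (nth t0 s i).
have /choice[step stepP] s : exists t, valid s -> Q s t.
  by have [/H[t Qt]|nv] := pselect (valid s); [exists t|exists t0].
pose hist := fix hist n := if n is m.+1 then rcons (hist m) (step (hist m)) else [::].
pose p n := step (hist n).
have histE n : hist n = mkseq p n by elim: n => // n IH; rewrite mkseqS /= {1}IH.
have v n : valid (hist n).
  elim: n => [|n IH] i //=; have sn : size (hist n) = n by rewrite histE size_mkseq.
  rewrite size_rcons sn ltnS => lein; rewrite nth_rcons -cats1 takel_cat ?sn//.
  move: lein; rewrite leq_eqVlt => /orP[/eqP ->|lt].
    by rewrite ltnn eqxx -{1}sn take_size; exact: stepP.
  by rewrite lt; apply: IH; rewrite sn.
by exists p => n; rewrite -histE; apply: stepP.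
Qed.

Lemma choose_subseq (P : nat -> nat -> Prop) :
  (forall k N, exists n, (N <= n)%N /\ P k n) ->
  exists phi : nat -> nat, increasing_seq phi /\ forall k, P k (phi k).
Proof.
move=> H; have /choice[c cP] (kN : nat * nat) : exists n, (kN.2 <= n)%N /\ P kN.1 n.
  exact: H.
pose phi := fix phi k := if k is j.+1 then c (k, (phi j).+1) else c (0%N, 0%N).
exists phi; split; last by case=> [|k]; exact: (cP (_, _)).2.
by apply/increasing_seqP => n; exact: (cP (n.+1, (phi n).+1)).1.
Qed.

Lemma increasing_seq_ge (phi : nat -> nat) n : increasing_seq phi -> (n <= phi n)%N.
Proof.
move=> /increasing_seqP phiS; elim: n => // n IH.
exact: leq_ltn_trans IH (phiS n).
Qed.

Lemma increasing_seq_cvg (phi : nat -> nat) : increasing_seq phi -> phi @ \oo --> \oo.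
Proof.
move=> ip A [N _ NA]; exists N => // n /= Nn; apply: NA => /=.
exact: leq_trans Nn (increasing_seq_ge _ ip).
Qed.

Lemma increasing_seq_comp (phi psi : nat -> nat) :
  increasing_seq phi -> increasing_seq psi -> increasing_seq (phi \o psi).
Proof. by move=> ip iq m n; rewrite -iq; exact: ip. Qed.

End Subsequences.

Section Ultrafilters.

Lemma ultra_fmap (T U : Type) (g : T -> U) (F : set_system T) :
  UltraFilter F -> UltraFilter (fmap g F).
Proof.
move=> UF; split; first exact: fmap_proper_filter.
move=> G GG sG; apply/seteqP; split=> // A GA.
have [//|FnA] := in_ultra_setVsetC (g @^-1` A) UF.
have GnA : G (~` A) by apply: sG.
by have /filter_ex [? []] : G (A `&` ~` A) by exact: filterI.
Qed.

Lemma ultra_bounded_lim (R : realType) (T : Type) (F : set_system T) (g : T -> R) M :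
  UltraFilter F -> F [set x | `|g x| <= M] -> exists l : R, g @ F --> l.
Proof.
move=> UF FM; have := @segment_compact R (- M) M; rewrite compact_ultra.
have UgF := ultra_fmap g UF.
move=> /(_ (fmap g F) UgF) [|l [_ gl]]; last by exists l.
have sM : [set x | `|g x| <= M] `<=` g @^-1` `[- M, M].
  by move=> x; rewrite /= in_itv /= ler_norml.
exact: filterS sM FM.
Qed.

(** Stands in for a subsequence with indices in [P]: along such an ultrafilter every bounded real
    sequence converges. *)
Lemma infinitely_often_ultra (P : set nat) :
  (forall N, exists n, (N <= n)%N /\ P n) ->
  exists U : set_system nat, [/\ UltraFilter U, \oo `<=` U & U P].
Proof.
move=> HP.
have PF : ProperFilter (within P \oo).
  apply: Build_ProperFilter_ex => A [N _ NA].
  have [n [Nn Pn]] := HP N; exists n; exact: (NA n Nn Pn).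
have [U [UU sU]] := ultraFilterLemma PF.
exists U; split=> //; last by apply: sU; exact: withinT.
apply: subset_trans sU => A AN; rewrite /within/=; apply: filterS AN => ? ?; exact.
Qed.

End Ultrafilters.

Lemma null_sequence (R : realType) : exists eps : nat -> R,
  (forall n, 0 < eps n) /\ forall e, 0 < e -> \forall n \near \oo, eps n < e.
Proof.
exists (fun n => n.+1%:R^-1); split=> [n|e e0]; first by rewrite invr_gt0.
exact: (near_infty_natSinv_lt (PosNum e0)).
Qed.

Section EberleinSequence.
Context {R : realType} {E : completeNormedModType R}.
Implicit Types (f g : E -> R) (k : R).

(* Helly's theorem; points of the bidual are represented by their action [phi] on
   bounded functionals.  The induction removes one vanishing condition at a time,
   by a one-dimensional Hahn-Banach step. *)
Lemma helly (phi : (E -> R) -> R) (c : R) (s : seq E) : 0 < c ->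
  (forall a k k' f g, blin k f -> blin k' g ->
    phi (fun x => a * f x + g x) = a * phi f + phi g) ->
  (forall x, exists2 f, blin 1 f & c < `|phi f - f x|) ->
  forall x, exists f, [/\ blin 1 f, forall y, y \in s -> f y = 0 &
    c < `|phi f - f x|].
Proof.
move=> c0 phiL H; elim: s => [|y s IH] x.
  by have [f bf cf] := H x; exists f.
apply: contrapT => nf.
pose psi f := phi f - f x.
have phi0 : phi (fun=> 0) = 0.
  have b0 := @blin_cst0 R E.
  have := phiL 1 _ _ _ _ b0 b0; under eq_fun do rewrite mulr0 addr0; lra.
have psiZ a k f : blin k f -> psi (fun z => a * f z) = a * psi f.
  move=> bf; have b0 := @blin_cst0 R E.
  have := phiL a _ _ _ _ bf b0; under eq_fun do rewrite addr0.
  by rewrite phi0 addr0 /psi => ->; rewrite mulrBr.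
have psiB k k' f g : blin k f -> blin k' g -> psi (fun z => f z - g z) = psi f - psi g.
  move=> bf bg; have := phiL (-1) _ _ _ _ bg bf.
  under eq_fun do rewrite mulN1r addrC; rewrite /psi => ->; ring.
have small q h : 0 < q -> blin q h -> h y = 0 -> (forall z, z \in s -> h z = 0) ->
    `|psi h| <= c * q.
  move=> q0 bh hy hs; rewrite leNgt; apply/negP => lt; apply: nf.
  exists (fun z => q^-1 * h z); split.
  - apply: blin_le (blin_scale q^-1 bh).
    by rewrite normfV gtr0_norm// mulVf// gt_eqF.
  - by move=> z; rewrite inE => /orP[/eqP ->|/hs ->]; rewrite ?hy mulr0.
  - rewrite -/(psi _) (psiZ _ _ _ bh) normrM normfV (gtr0_norm q0).
    by rewrite mulrC ltr_pdivlMr.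
pose K r f := [/\ blin r f, f y = 1 & forall z, z \in s -> f z = 0].
have Kpos r f : K r f -> 0 < r.
  case=> bf fy _; have := blin_bound bf y; rewrite fy normr1.
  move=> r1; rewrite ltNge; apply/negP => r0.
  by have := mulr_le0_ge0 r0 (normr_ge0 y); lra.
have Kscale f : blin 1 f -> (forall z, z \in s -> f z = 0) -> f y != 0 ->
    K `|(f y)^-1| (fun z => (f y)^-1 * f z).
  move=> bf fs fy0; split; first by rewrite -[X in blin X _]mulr1; exact: blin_scale.
    by rewrite mulVf.
  by move=> z /fs ->; rewrite mulr0.
have KK r q f g : K r f -> K q g -> psi f - c * r <= psi g + c * q.
  move=> Kf Kg; have r0 := Kpos _ _ Kf; have q0 := Kpos _ _ Kg.
  have [[bf fy fs] [bg gy gs]] := (Kf, Kg).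
  have := small _ _ (addr_gt0 r0 q0) (blin_sub bf bg).
  rewrite fy gy subrr (psiB _ _ _ _ bf bg) ler_norml => /(_ erefl).
  have fgs z : z \in s -> f z - g z = 0 by move=> zs; rewrite fs// gs// subrr.
  move=> /(_ fgs) /andP[_]; lra.
pose S := [set v | exists r f, K r f /\ v = psi f - c * r].
have [[r0 [f0 Kf0]]|nK] := pselect (exists r f, K r f); last first.
  have [f [bf fs cf]] := IH x; apply: nf; exists f; split=> //.
  move=> z; rewrite inE => /orP[/eqP ->|/fs //].
  by apply/eqP/negP => /negP fy0; apply: nK; do 2 eexists; exact: Kscale fy0.
have hS : has_sup S.
  split; first by exists (psi f0 - c * r0), r0, f0.
  by exists (psi f0 + c * r0) => _ [r [f [Kf ->]]]; exact: KK.
(* This [a] lies between all [psi f - c * r] and all [psi g + c * q]. Hence [psi f - a * f y] is at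
   most [c] in absolute value for every [f] of norm at most 1 that vanishes on [s], against the
   induction hypothesis at [x + a *: y]. *)
pose a := sup S.
have [f [bf fs]] := IH (x + a *: y); rewrite ltNge => /negP; apply.
have -> : phi f - f (x + a *: y) = psi f - a * f y.
  by rewrite (blinD bf) (blinZ bf) opprD addrA.
have [fy0|fy0] := eqVneq (f y) 0.
  by rewrite fy0 mulr0 subr0 -[c]mulr1; apply: small => //; exact: ltr01.
pose v := f y; pose g z := v^-1 * f z.
have Kf : K `|v^-1| g := Kscale _ bf fs fy0.
rewrite -/v.
have psig : psi g = v^-1 * psi f by exact: psiZ bf.
have up : psi g - c * `|v^-1| <= a.
  by apply: sup_upper_bound => //; exists `|v^-1|, g.
have dn : a <= psi g + c * `|v^-1|.
  by apply: sup_le_ub; [exact: hS.1|move=> _ [r [h [Kh ->]]]; exact: KK].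
have -> : psi f - a * v = v * (psi g - a) by rewrite psig mulrBr mulVKf// [a * v]mulrC.
rewrite normrM -ler_pdivlMl ?normr_gt0//.
rewrite -normfV mulrC ler_distl; apply/andP; split; lra.
Qed.

(** The limits [phi f] along [U] define a point of the bidual. Its distance from [E] is positive,
    since otherwise completeness would give a weak limit of [U]. Helly's theorem then supplies [f m]
    vanishing at the earlier [z n] with [phi (f m) > c]; the set where [f m > c] belongs to [U], so
    finitely many of these sets meet inside [W], which supplies the next point. *)
Lemma eberlein_sequence (W : set E) (M : R) (U : set_system (weak E)) :
  UltraFilter U -> U W -> (forall x, W x -> `|x| <= M) ->
  (forall x : E, ~ (U --> (x : weak E))) ->
  exists c (z : nat -> E) (f : nat -> E -> R),
    [/\ 0 < c, forall n, W (z n), forall m, blin 1 (f m),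
      forall m n, (m <= n)%N -> c < f m (z n) &
      forall m n, (n < m)%N -> f m (z n) = 0].
Proof.
move=> UU UW WM nU.
pose phi (f : E -> R) : R := lim (f @ U).
have phiP k f : blin k f -> f @ U --> phi f.
  move=> bf.
  have sW : W `<=` [set x | `|f x| <= `|k| * M].
    move=> x Wx /=; apply: le_trans (blin_bound bf x) _.
    apply: (@le_trans _ _ (`|k| * `|x|)); first by rewrite ler_wpM2r// ler_norm.
    by rewrite ler_wpM2l// WM.
  have [l fl] := ultra_bounded_lim UU (filterS sW UW).
  by rewrite /phi (cvg_lim (@norm_hausdorff _ R^o) fl).
have phiL a k k' f g : blin k f -> blin k' g ->
    phi (fun x => a * f x + g x) = a * phi f + phi g.
  move=> bf bg; apply: (cvg_lim (@norm_hausdorff _ R^o)).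
  by apply: cvgD (phiP _ _ bg); apply: cvgMr (phiP _ _ bf).
have [c c0 cP] : exists2 c, 0 < c & forall x, exists2 f, blin 1 f & c < `|phi f - f x|.
  apply: contrapT => nc; have [eps [eps0 small]] := null_sequence R.
  have /choice[x xP] (n : nat) : exists x, forall f, blin 1 f ->
      `|phi f - f x| <= eps n.
    apply: contrapT => nx; apply: nc; exists (eps n) => //.
    move=> y; apply: contrapT => ny; apply: nx; exists y => f bf.
    by rewrite leNgt; apply/negP => lt; apply: ny; exists f.
  have xC m n : `|x m - x n| <= eps m + eps n.
    have [f bf <-] := norming (x m - x n); rewrite (blinB bf).
    have := xP m _ bf; have := xP n _ bf; rewrite !ler_norml => /andP[? ?] /andP[? ?]; lra.
  have : cvg (x @ \oo).
    apply/cauchy_cvgP/cauchy_ballP => e e0.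
    have e20 : 0 < e / 2 by rewrite divr_gt0.
    have [N _ NP] := small _ e20.
    exists ([set x n | n in [set n | (N <= n)%N]], [set x n | n in [set n | (N <= n)%N]]).
      by split; exists N => // n /= Nn; exists n.
    move=> [_ _] /= [[m Nm <-] [n Nn <-]]; rewrite -ball_normE/=.
    have := xC m n; have := NP _ Nm; have := NP _ Nn; rewrite /=; lra.
  move=> /cvg_ex[l xl]; apply: (nU l); apply/weak_cvg1P => f bf.
  suff <- : phi f = f l by exact: phiP bf.
  apply/eqP; rewrite -subr_eq0 -normr_le0; apply/ler_addgt0Pr => e e0; rewrite add0r.
  have e20 : 0 < e / 2 by rewrite divr_gt0.
  have /cvgrPdist_lt/(_ _ e20) xle := xl.
  have [n [/= n1 n2]] := filter_ex (filterI (small _ e20) xle).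
  have := xP n _ bf; have := blin_bound bf (l - x n); rewrite (blinB bf) mul1r.
  rewrite !ler_norml => ? ?; apply/andP; split; lra.
pose Q (s : seq ((E -> R) * E)) (p : (E -> R) * E) :=
  [/\ blin 1 p.1, c < phi p.1, W p.2, c < p.1 p.2 &
   forall i, (i < size s)%N -> p.1 (nth (fun=> 0, 0) s i).2 = 0 /\
     c < (nth (fun=> 0, 0) s i).1 p.2].
have evU f : blin 1 f -> c < phi f -> U [set z | c < f z].
  by move=> bf cf; exact: (cvgr_gt _ (phiP _ _ bf) _ cf).
have [|p pP] := @sequence_by_prefix _ Q (fun=> 0, 0).
  move=> s sP.
  have [f [bf fs cf]] : exists f, [/\ blin 1 f,
      forall y, y \in [seq q.2 | q <- s] -> f y = 0 & c < phi f].
    (* Helly's theorem at 0 bounds [|phi f|] from below; a negative sign is removed by passing to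
       [- f]. *)
    have [f [bf fs]] := helly [seq q.2 | q <- s] c0 phiL cP 0.
    rewrite (blin0 bf) subr0; have [f0|f0] := leP 0 (phi f).
      by move=> cf; exists f; split=> //; rewrite -(ger0_norm f0).
    rewrite ltr0_norm// => cf; exists (fun z => - f z); split.
    - exact: blin_opp.
    - by move=> y /fs ->; rewrite oppr0.
    - have b0 := @blin_cst0 R E.
      have p0 := phiL 1 _ _ _ _ b0 b0.
      have := phiL (-1) _ _ _ _ bf b0; under eq_fun do rewrite mulN1r addr0.
      move=> ->; move: p0; under eq_fun do rewrite mulr0 addr0; lra.
  have Us : U [set z | forall i, (i < size s)%N -> c < (nth (fun=> 0, 0) s i).1 z].
    elim: {1 3}(size s) (leqnn (size s)) => [_|n IH ns].
      by apply: filterS UW => z _.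
    have [b1 b2 _ _ _] := sP n ns.
    apply: filterS (filterI (evU _ b1 b2) (IH (ltnW ns))) => z [/= z1 z2] i.
    by rewrite ltnS leq_eqVlt => /orP[/eqP ->|/z2].
  have [z [[Wz fz] sz]] := filter_ex (filterI (filterI UW (evU _ bf cf)) Us).
  exists (f, z); split=> // i si /=; split; last exact: sz.
  by apply: fs; apply/mapP; exists (nth (fun=> 0, 0) s i) => //; exact: mem_nth.
exists c, (fun n => (p n).2), (fun n => (p n).1); split=> //.
- by move=> n; have [] := pP n.
- by move=> n; have [] := pP n.
- move=> m n; rewrite leq_eqVlt => /orP[/eqP ->|mn]; first by have [] := pP n.
  have [_ _ _ _ /(_ m)] := pP n; rewrite size_mkseq nth_mkseq// => /(_ mn).
  by case.
- move=> m n nm; have [_ _ _ _ /(_ n)] := pP m; rewrite size_mkseq nth_mkseq//.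
  by move=> /(_ nm) [].
Qed.

End EberleinSequence.

(** * Simons' inequality *)

Section Simons.
Context {R : realType} {T : topologicalType}.
Variables (L : set T) (g : nat -> T -> R^o) (b : R).
Hypothesis L_compact : compact L.
Hypothesis g_continuous : forall n, continuous (g n).
Hypothesis g_bounded : forall n y, L y -> `|g n y| <= b.

Let H n : set (T -> R^o) := hull [set g m | m in [set m | (n <= m)%N]].

Let H_mem n h : H n h ->
  [/\ continuous h, forall y, L y -> `|h y| <= b &
    forall y v, (forall m, (n <= m)%N -> g m y < v) -> h y < v].
Proof.
move=> Hh; split.
- apply: (Hh [set f : T -> R^o | continuous f]).
    move=> t u v _ _ cu cv y.
    by apply: cvgD; apply: cvgMr; [exact: cu|exact: cv].
  by move=> _ [m _ <-]; exact: g_continuous.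
- move=> y Ly; apply: (Hh [set f : T -> R^o | `|f y| <= b]).
    move=> t u v t0 t1 /=; rewrite !ler_norml => /andP[u1 u2] /andP[v1 v2].
    have -> : (t *: u + (1 - t) *: v) y = t * u y + (1 - t) * v y by [].
    by apply/andP; split; nra.
  by move=> _ [m _ <-]; exact: g_bounded.
- move=> y v gv; apply: (Hh [set f : T -> R^o | f y < v]).
    move=> t u w t0 t1 /= uv wv.
    have -> : (t *: u + (1 - t) *: w) y = t * u y + (1 - t) * w y by [].
    have [->|tn1] := eqVneq t 1; first by rewrite subrr mul0r mul1r addr0.
    have : 0 < 1 - t by rewrite subr_gt0 lt_neqAle tn1.
    by nra.
  by move=> _ [m nm <-]; exact: gv.
Qed.

Let HS n : H n.+1 `<=` H n.
Proof. by apply: hullS => _ [m nm <-]; exists m => //; exact: ltnW. Qed.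

(** For [s] of length [n] this is [2 ^ n * \sum_(k < n) 2 ^- k.+1 * s_k]; [rev] is there because
    prefixes grow at their end. *)
Let acc (s : seq (T -> R^o)) : T -> R := foldr (fun h a y => 2 * a y + h y) (fun=> 0) (rev s).

(** An almost minimiser over [H n] of the supremum of [a + h] on [L], expressed by upper bounds [c]
    in place of suprema. *)
Let near_minimal d (a : T -> R) n : 0 < d -> L !=set0 ->
  (exists B, forall y, L y -> `|a y| <= B) ->
  exists2 h, H n h & forall h' c, H n h' -> (forall y, L y -> a y + h' y <= c) ->
    forall y, L y -> a y + h y <= c + d.
Proof.
move=> d0 [y0 Ly0] [B aB].
pose S := [set c | exists2 h, H n h & forall y, L y -> a y + h y <= c].
have hS : has_inf S.
  split.
    exists (B + b), (g n); first by apply: sub_hull; exists n => /=.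
    move=> y Ly; apply: lerD; last exact: le_trans (ler_norm _) (g_bounded _ Ly).
    exact: le_trans (ler_norm _) (aB _ Ly).
  exists (a y0 - b) => c [h Hh /(_ _ Ly0)].
  have [_ /(_ _ Ly0) + _] := H_mem Hh; rewrite ler_norml => /andP[? _]; lra.
have [c [h Hh hc] cS] := inf_adherent d0 hS.
exists h => // h' c' Hh' hc' y Ly.
have : inf S <= c' by apply: ge_inf; [exact: hS.2|exists h'].
have := hc _ Ly; lra.
Qed.

(* Simons' argument: the [h n] nearly minimise the maximum of
   [2 ^ n * (\sum_(k < n) 2 ^- k.+1 * h k) + h n], so that wherever the full
   convex combination [\sum_k 2 ^- k.+1 * h k] attains its maximum, all its
   normalised tails stay large. *)
Lemma simons_inequality e : 0 < e ->
  (forall y v, L y -> 0 < v -> \forall m \near \oo, g m y < v) ->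
  exists2 h, hull (range g) h & forall y, L y -> h y <= e.
Proof.
move=> e0 g_limsup.
have H0 : H 0 `<=` hull (range g) by apply: hullS => _ [m _ <-]; exists m.
have [L0|L0] := pselect (L !=set0); last first.
  exists (g 0); first by apply: sub_hull; exists 0%N.
  by move=> y Ly; case: L0; exists y.
apply: contrapT => nh.
have big h : H 0 h -> exists2 y, L y & e < h y.
  move=> Hh; apply: contrapT => ny; apply: nh; exists h; first exact: H0.
  by move=> y Ly; rewrite leNgt; apply/negP => lt; apply: ny; exists y.
(* The errors [dn n] add up to at most [d], and truncating a tail costs another [d]. So [e / 2]
   remains, against the bound of the [g m] by [e / 2] at the limit point [yl]. *)
pose d := e / 4; have d0 : 0 < d by rewrite divr_gt0.
pose dn n := d * 2^-1 ^+ n.+1.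
have dn0 n : 0 < dn n by rewrite mulr_gt0// exprn_gt0.
pose Q (s : seq (T -> R^o)) h := H (size s) h /\
  forall h' c, H (size s) h' -> (forall y, L y -> acc s y + h' y <= c) ->
    forall y, L y -> acc s y + h y <= c + dn (size s).
have [|h hP] := @sequence_by_prefix _ Q (fun=> 0).
  move=> s sP; have [|h] := @near_minimal (dn (size s)) (acc s) (size s) (dn0 _) L0;
    last by exists h.
  have : forall i, (i < size s)%N -> forall y, L y -> `|nth (fun=> 0) s i y| <= b.
    move=> i si; have [Hi _] := sP i si; have [_ + _] := H_mem Hi; exact.
  clear; elim/last_ind : s => [|s h IH] sb.
    by exists 0 => y _; rewrite /acc/= normr0.
  have [|B aB] := IH.
    move=> i si y Ly; have := sb i; rewrite size_rcons nth_rcons si.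
    by apply => //; exact: leqW.
  exists (2 * B + b) => y Ly; rewrite /acc rev_rcons/=.
  apply: le_trans (ler_normD _ _) _; apply: lerD.
    by rewrite normrM gtr0_norm// ler_pM2l//; exact: aB.
  by have := sb (size s); rewrite size_rcons nth_rcons ltnn eqxx; apply.
pose a n := acc (mkseq h n).
have aS n y : a n.+1 y = 2 * a n y + h n y by rewrite /a mkseqS /acc rev_rcons.
have Hh n : H n (h n) by have [] := hP n; rewrite size_mkseq.
have hmin n h' c : H n h' -> (forall y, L y -> a n y + h' y <= c) ->
    forall y, L y -> a n y + h n y <= c + dn n.
  by have [_] := hP n; rewrite size_mkseq; apply.
(* Truncated normalised tails: [h n], [h n.+1], ... with weights 1/2, 1/4, ..., the last weight
   being repeated so that they sum to 1 and [tl n j] stays in the hull. *)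
pose tl := fix tl n j : T -> R^o :=
  if j is i.+1 then 2^-1 *: (h n + tl n.+1 i) else h n.
have tlH n j : H n (tl n j).
  elim: j n => [m|j IH m]; first exact: Hh.
  by apply: hull_half; [exact: Hh|exact: HS].
have tlS n j y : tl n j.+1 y = 2^-1 * (h n y + tl n.+1 j y) by [].
have tl_acc n j y : a n y + tl n j y = 2 ^+ n * tl 0%N (n + j)%N y.
  elim: n j => [j|n IH j]; first by rewrite mul1r /a/= add0r.
  have := IH j.+1; rewrite tlS aS addnS addSn exprS -mulrA => <-; lra.
have tl_close : forall n j i y, L y -> `|tl n (j + i)%N y - tl n j y| <= 2 * b * 2^-1 ^+ j.
  move=> n j i y Ly; elim: j n => [m|j IH m].
    rewrite add0n mulr1; have [_ /(_ _ Ly) t1 _] := H_mem (tlH m i).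
    have [_ /(_ _ Ly) t2 _] := H_mem (tlH m 0%N).
    by apply: le_trans (ler_normB _ _) _; lra.
  rewrite addSn !tlS -mulrBr opprD addrACA subrr add0r normrM gtr0_norm//.
  by rewrite exprS mulrCA ler_pM2l//; exact: IH.
have /choice[y yP] N : exists y, L y /\ forall x, L x -> tl 0%N N x <= tl 0%N N y.
  have [ct _ _] := H_mem (tlH 0%N N).
  have [y] := compact_EVT_max L0 L_compact (continuous_subspaceT ct).
  move=> /set_mem Ly yM; exists y; split=> // x Lx.
  by apply: yM; exact: mem_set.
have tl_large n j : e - d * (1 - 2^-1 ^+ n) <= tl n j (y (n + j)%N).
  elim: n j => [j|n IH j].
    rewrite subrr mulr0 subr0 add0n.
    have [x Lx ex] := big _ (tlH 0%N j).
    exact: le_trans (ltW ex) ((yP j).2 _ Lx).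
  have [Ly ymax] := yP (n.+1 + j)%N.
  (* The competitor is [tl n j.+1]: the sum [a n + tl n j.+1] is a multiple of the truncated
     combination maximised at this [y]. Near minimality gives [h n <= tl n j.+1 + dn n] there, and
     since [tl n j.+1] is the mean of [h n] and [tl n.+1 j], the latter loses at most [dn n]. *)
  have := hmin n _ (a n (y (n.+1 + j)%N) + tl n j.+1 (y (n.+1 + j)%N)) (tlH n j.+1) _ _ Ly.
  have le x : L x -> a n x + tl n j.+1 x <=
      a n (y (n.+1 + j)%N) + tl n j.+1 (y (n.+1 + j)%N).
    by move=> Lx; rewrite !tl_acc addnS -addSn ler_pM2l ?exprn_gt0// ymax.
  move=> /(_ le); have := IH j.+1; rewrite addnS -addSn tlS /dn exprS.
  set w := 2^-1 ^+ n; lra.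
have [U [UU sU _]] : exists U : set_system nat, [/\ UltraFilter U, \oo `<=` U & U setT].
  by apply: infinitely_often_ultra => N; exists N.
have [yl [Lyl yU]] : L `&` [set p | fmap y U --> p] !=set0.
  move: L_compact; rewrite compact_ultra; apply.
    exact: ultra_fmap.
  by apply: (@filterE _ U) => n; exact: (yP n).1.
have [n _ nP] := g_limsup yl (e / 2) Lyl (divr_gt0 e0 (ltr0Sn _ 1)).
have [j jP] : exists j, 2 * b * 2^-1 ^+ j <= d.
  have b0 : 0 < 2 * b + 1.
    have [y0 Ly0] := L0; have := g_bounded 0%N Ly0; have := normr_ge0 (g 0%N y0); lra.
  have [j] := filter_ex (near_infty_natSinv_expn_lt (PosNum (divr_gt0 d0 b0))).
  rewrite /= div1r -exprVn ltr_pdivlMr// => jd; exists j.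
  have : 0 < 2^-1 ^+ j :> R by rewrite exprn_gt0.
  lra.
have [ct _ lt] := H_mem (tlH n j).
have := lt yl (e / 2) nP; apply/negP; rewrite -leNgt.
have cU : tl n j (y N) @[N --> U] --> tl n j yl by apply: continuous_cvg (ct yl) _.
apply: (cvgr_to_ge cU); apply: sU; exists (n + j)%N => // N /= nN.
have [Ly _] := yP N.
have := tl_large n (N - n)%N; have := tl_close n j (N - n - j)%N _ Ly.
rewrite subnKC; last by rewrite leq_subRL// (leq_trans _ nN)// leq_addr.
rewrite subnKC; last by rewrite (leq_trans _ nN)// leq_addr.
have : 0 < d * 2^-1 ^+ n by rewrite mulr_gt0// exprn_gt0.
have : d = e / 4 by [].
have arith (p q r s e' d' : R) : p <= d' -> d' = e' / 4 -> 0 < q ->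
    - p <= s - r <= p -> e' - (d' - q) <= s -> e' / 2 <= r by lra.
by move: jP; rewrite ler_norml mulrBr mulr1; exact: arith.
Qed.

End Simons.

(** * A criterion for weak compactness *)

Section WeakCompactness.
Context {R : realType} {E : completeNormedModType R}.

(** The sequences that serve two points are interleaved to serve a combination. Countability later
    allows one diagonal subsequence for all the points involved. *)
Lemma hull_sequence (V : lmodType R) (K : set V) w : hull K w ->
  exists2 s : nat -> V, forall i, K (s i) & hull (range s) w.
Proof.
move=> hw; apply: (hw [set w | exists2 s : nat -> V, forall i, K (s i) & hull (range s) w]);
  last by move=> x Kx; exists (fun=> x) => //; apply: sub_hull; exists 0%N.
move=> t x y t0 t1 [s Ks xs] [r Kr yr].
exists (fun i => if odd i then r i./2 else s i./2); first by move=> i; case: ifP.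
apply: hull_cvx => //.
  apply: hullS xs => _ [i _ <-]; exists i.*2 => //.
  by rewrite odd_double doubleK.
apply: hullS yr => _ [i _ <-]; exists i.*2.+1 => //.
by rewrite /= odd_double /= uphalf_double.
Qed.

(** Banach-Alaoglu for a sequence: the values at [x] are bounded by the norm of [x], and the bound
    passes to the limit. *)
Lemma ultra_pointwise_lim (f : nat -> E -> R) (U : set_system nat) :
  UltraFilter U -> (forall m, blin 1 (f m)) ->
  exists2 F, blin 1 F & forall x, f m x @[m --> U] --> F x.
Proof.
move=> UU bf; have /choice[F FP] x : exists l : R, f m x @[m --> U] --> l.
  apply: (@ultra_bounded_lim R _ U (f ^~ x) `|x|).
  by apply: (@filterE _ U) => m; have := blin_bound (bf m) x; rewrite mul1r.
by exists F => //; exact: blin_lim bf FP.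
Qed.

Lemma weak_closure_vanish k G (X : set E) y : blin k G ->
  (forall x, X x -> G x = 0) -> @closure (weak E) X y -> G y = 0.
Proof.
move=> bG GX cXy; have /weak_cvgP /(_ _ _ bG) Gy : nbhs (y : weak E) --> (y : weak E) by [].
apply/eqP; rewrite -normr_le0; apply/ler_addgt0Pr => e e0; rewrite add0r.
have /cvgrPdist_lt /(_ _ e0) /cXy [x [Xx /=]] := Gy.
by rewrite (GX x Xx) subr0 => /ltW.
Qed.

(* Contains the Krein-Smulian theorem (a single [K]) and Grothendieck's
   criterion (convex [K]). *)
Lemma weakly_compact_approx (W : set E) M : closed W -> cvx W ->
  (forall x, W x -> `|x| <= M) ->
  (forall e, 0 < e -> exists (K : set E) B, [/\ weakly_compact K,
     forall x, K x -> `|x| <= B &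
     forall x, W x -> exists2 w, hull K w & `|x - w| <= e]) ->
  weakly_compact W.
Proof.
move=> clW cW WM Wapprox; rewrite /weakly_compact compact_ultra => U UU UW.
apply: contrapT => nU.
have [|c [z [f [c0 zW bf fz_ge fz0]]]] := eberlein_sequence UU UW WM.
  move=> x Ux; apply: nU; exists x; split=> //.
  exact: closed_cvx_weak_lim clW cW UW Ux.
(* The final estimate is [h (z N) <= h (w N) + 2 * e <= 3 * e], which has to be below [c]. *)
pose e := c / 8; have e0 : 0 < e by rewrite divr_gt0.
have [K [B [cK KB KW]]] := Wapprox _ e0.
have /choice[w wP] n : exists w, hull K w /\ `|z n - w| <= e.
  by have [w] := KW _ (zW n); exists w.
have /choice[xs xsP] n : exists s : nat -> E, (forall i, K (s i)) /\ hull (range s) (w n).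
  by have [s] := hull_sequence (wP n).1; exists s.
(* One sequence through all the points of [K] used for the approximants [w n]; its default value
   also lies in [K]. *)
pose X q := if @unpickle (nat * nat)%type q is Some ni then xs ni.1 ni.2 else xs 0%N 0%N.
have KX q : K (X q) by rewrite /X; case: unpickle => [[n i]|]; exact: (xsP _).1.
have [U' [UU' sU' _]] : exists U, [/\ UltraFilter U, \oo `<=` U & U [set: nat]].
  by apply: infinitely_often_ultra => N; exists N.
have [F bF FP] := ultra_pointwise_lim UU' bf.
have Fz n : F (z n) = 0.
  have : f m (z n) @[m --> U'] --> (0 : R).
    apply: cvg_near_cst; apply: sU'; exists n.+1 => // m /= nm.
    by rewrite fz0.
  by move=> /(cvg_unique (@norm_hausdorff _ R^o)) /(_ (FP (z n))).
have [eps [eps0 epsP]] := null_sequence R.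
have [phi [phi_inc phiP]] : exists phi, increasing_seq phi /\
    forall k i, (i <= k)%N -> `|F (X i) - f (phi k) (X i)| < eps k.
  have [|phi [ip pP]] := @choose_subseq (fun k m =>
      forall i, (i <= k)%N -> `|F (X i) - f m (X i)| < eps k); last by exists phi.
  move=> k N.
  have : U' [set m | forall i, (i < k.+1)%N -> `|F (X i) - f m (X i)| < eps k].
    elim: k.+1 => [|j IH]; first by apply: filterE.
    have /cvgrPdist_lt /(_ _ (eps0 k)) jU := FP (X j).
    apply: filterS (filterI IH jU) => m [/= m1 m2] i.
    by rewrite ltnS leq_eqVlt => /orP[/eqP ->|/m1].
  have NU : U' [set m | (N <= m)%N] by apply: sU'; exists N.
  by move=> /(filterI NU) /filter_ex [m [Nm mP]]; exists m.
have fX i : f (phi k) (X i) @[k --> \oo] --> F (X i).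
  apply/cvgrPdist_lt => d d0; have [N _ NP] := epsP _ d0.
  exists (maxn N i) => // k /=; rewrite geq_max => /andP[Nk ik].
  exact: lt_trans (phiP _ _ ik) (NP _ Nk).
(* On [L] the [g k] have limit superior at most 0, while [g k (z n) = f (phi k) (z n) > c] for
   [n >= phi k] because [F] vanishes at [z n]. Simons' inequality makes a convex combination small
   on [L], and for large [n] the combination keeps the lower bound [c] at [z n]. *)
pose g k x := f (phi k) x - F x.
have bg k : blin (1 + 1) (g k) by exact: blin_sub.
pose L : set (weak E) := K `&` @closure (weak E) (range X).
have cL : compact L by apply: compact_closedI => //; exact: closed_closure.
have cont_blin k G : blin k G -> continuous (G : weak E -> R^o).
  by move=> bG y; have /weak_cvgP /(_ _ _ bG) : nbhs (y : weak E) --> (y : weak E) by [].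
have [|||h Hh hL] := @simons_inequality R (weak E) L g (2 * B) cL _ _ _ e0.
- by move=> n; exact: cont_blin (bg n).
- move=> n y [Ky _]; apply: le_trans (blin_bound (bg n) y) _.
  by rewrite ler_pM2l ?addr_gt0//; exact: KB.
(* A pointwise limit [F'] along indices where [g n y >= v] agrees with [F] on [range X], hence at
   [y], which lies in its weak closure. *)
- move=> y v [Ky cy] v0; apply: contrapT => nv.
  have [N|V [UV sV VP]] := @infinitely_often_ultra [set n | v <= g n y].
    apply: contrapT => nN; apply: nv; exists N => // m /= Nm.
    by rewrite ltNge; apply/negP => vm; apply: nN; exists m.
  have [F' bF' F'P] := ultra_pointwise_lim UV (fun m => bf (phi m)).
  have : F' y - F y = 0.
    apply: weak_closure_vanish (blin_sub bF' bF) _ cy => _ [i _ <-].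
    have : f (phi m) (X i) @[m --> V] --> F (X i) by apply: cvg_trans (fX i); exact: cvg_app.
    move=> /(cvg_unique (@norm_hausdorff _ R^o)) /(_ (F'P (X i))) ->.
    by rewrite subrr.
  have : v <= F' y - F y.
    have gV : f (phi m) y - F y @[m --> V] --> F' y - F y.
      by apply: cvgB; [exact: F'P|exact: cvg_cst].
    exact: (cvgr_to_ge gV VP).
  by move=> + F'F; rewrite F'F leNgt v0.
have bh : blin (1 + 1) h.
  apply: (Hh [set h : E -> R^o | blin (1 + 1) h]); last by move=> _ [k _ <-]; exact: bg.
  move=> t u v t0 t1 bu bv.
  have t10 : 0 <= 1 - t by rewrite subr_ge0.
  have := blin_add (blin_scale t bu) (blin_scale (1 - t) bv).
  by rewrite !ger0_norm// -mulrDl addrC subrK mul1r.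
have [N NP] : exists N, forall n, (N <= n)%N -> c <= h (z n).
  apply: (Hh [set h : E -> R^o | exists N, forall n, (N <= n)%N -> c <= h (z n)]).
    move=> t u v t0 t1 [N1 P1] [N2 P2]; exists (maxn N1 N2) => n.
    rewrite geq_max => /andP[/P1 c1 /P2 c2].
    have -> : (t *: u + (1 - t) *: v) (z n) = t * u (z n) + (1 - t) * v (z n) by [].
    by nra.
  move=> _ [k _ <-]; exists (phi k) => n /fz_ge /ltW.
  by rewrite /g Fz subr0.
have hw : h (w N) <= e.
  apply: (hull_min _ _ (xsP N).2 : [set x : E | h x <= e] (w N)).
    move=> t u v t0 t1 /= hu hv.
    by rewrite (blinD bh) !(blinZ bh); nra.
  move=> _ [i _ <-]; apply: hL; split; first exact: (xsP _).1.
  apply: subset_closure; exists (pickle (N, i)) => //.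
  by rewrite /X pickleK.
have := NP _ (leqnn N); have := blin_bound bh (z N - w N).
rewrite (blinB bh) ler_norml => /andP[_]; have := (wP N).2.
move: hw c0; rewrite /e; lra.
Qed.

End WeakCompactness.

(** * Weak limits and weakly compact sets *)

Section WeakSequences.
Context {R : realType} {E : normedModType R}.
Implicit Types (x y : nat -> E).

Lemma weak_cvg_seqP x (l : E) :
  weak_cvg x l <-> forall f, blin 1 f -> f (x n) @[n --> \oo] --> f l.
Proof. by rewrite /weak_cvg weak_cvg1P. Qed.

Lemma weak_cvg_subseq x l phi : increasing_seq phi -> weak_cvg x l -> weak_cvg (x \o phi) l.
Proof.
move=> ip /weak_cvg_seqP xl; apply/weak_cvg_seqP => f bf.
by have := cvg_comp _ _ (increasing_seq_cvg ip) (xl f bf).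
Qed.

Lemma weak_cvgD x y l m : weak_cvg x l -> weak_cvg y m ->
  weak_cvg (fun n => x n + y n) (l + m).
Proof.
move=> /weak_cvg_seqP xl /weak_cvg_seqP ym; apply/weak_cvg_seqP => f bf.
under eq_fun do rewrite (blinD bf); rewrite (blinD bf).
by apply: cvgD; [exact: xl|exact: ym].
Qed.

Lemma weak_cvgZ x l a : weak_cvg x l -> weak_cvg (fun n => a *: x n) (a *: l).
Proof.
move=> /weak_cvg_seqP xl; apply/weak_cvg_seqP => f bf.
under eq_fun do rewrite (blinZ bf); rewrite (blinZ bf).
by apply: cvgMr; exact: xl.
Qed.

Lemma weak_cvgB x y l m : weak_cvg x l -> weak_cvg y m ->
  weak_cvg (fun n => x n - y n) (l - m).
Proof.
move=> xl ym; rewrite -[- m]scaleN1r.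
under eq_fun do rewrite -[- y _]scaleN1r.
by apply: weak_cvgD => //; exact: weak_cvgZ.
Qed.

Lemma weak_cvg_cst (l : E) : weak_cvg (fun=> l) l.
Proof. by apply/weak_cvg_seqP => f bf; exact: cvg_cst. Qed.

Lemma cvg_weak_cvg x l : x @ \oo --> l -> weak_cvg x l.
Proof.
move=> /cvgrPdist_lt xl; apply/weak_cvg_seqP => f bf; apply/cvgrPdist_lt => e e0.
apply: filterS (xl _ e0) => n; apply: le_lt_trans.
by rewrite -(blinB bf); have := blin_bound bf (l - x n); rewrite mul1r.
Qed.

Lemma weak_lim_closed_cvx (C : set E) x l : closed C -> cvx C -> (forall n, C (x n)) ->
  weak_cvg x l -> C l.
Proof.
move=> clC cC Cx xl.
have FF : ProperFilter (fmap (x : nat -> weak E) \oo) by exact: fmap_proper_filter.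
by apply: (closed_cvx_weak_lim FF clC cC _ xl); apply: (@filterE _ \oo).
Qed.

Lemma ultra_weak_lim (T : Type) (U : set_system T) (a : T -> E) (K : set E) :
  UltraFilter U -> weakly_compact K -> U [set t | K (a t)] ->
  exists k, [/\ K k, forall f, blin 1 f -> f (a t) @[t --> U] --> f k &
    forall C, closed C -> cvx C -> U [set t | C (a t)] -> C k].
Proof.
move=> UU + UK; rewrite /weakly_compact compact_ultra.
have aU := ultra_fmap (a : T -> weak E) UU.
move=> /(_ _ aU UK) [k [Kk ak]]; exists k; split=> //.
  by move=> f bf; have /weak_cvg1P /(_ _ bf) := ak.
by move=> C clC cC CU; exact: closed_cvx_weak_lim clC cC CU ak.
Qed.

Lemma weakly_compact_set1 (k : E) : weakly_compact [set k].
Proof. exact: compact_set1. Qed.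

Lemma weakly_compactU (K L : set E) :
  weakly_compact K -> weakly_compact L -> weakly_compact (K `|` L).
Proof. exact: compactU. Qed.

Lemma weakly_compactI_closed_cvx (K C : set E) : weakly_compact K -> closed C ->
  cvx C -> weakly_compact (K `&` C).
Proof.
move=> cK clC cC; rewrite /weakly_compact compact_ultra => U UU UKC.
have [|k [Kk fk Ck]] := @ultra_weak_lim _ U id K UU cK.
  by apply: filterS UKC => x [].
exists k; split; last exact/weak_cvg1P.
by split=> //; apply: Ck => //; apply: filterS UKC => x [].
Qed.

Lemma weakly_compact_comb (K L : set E) a : weakly_compact K -> weakly_compact L ->
  weakly_compact [set k + a *: l | k in K & l in L].
Proof.
move=> cK cL; rewrite /weakly_compact compact_ultra => U UU UKL.
have /choice[p pP] (x : E) : exists kl : E * E,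
    [set k + a *: l | k in K & l in L] x -> [/\ K kl.1, L kl.2 & x = kl.1 + a *: kl.2].
  have [[k Kk [l Ll <-]]|nx] := pselect ([set k + a *: l | k in K & l in L] x).
    by exists (k, l).
  by exists (0, 0).
have [|k [Kk fk _]] := @ultra_weak_lim _ U (fst \o p) K UU cK.
  by apply: filterS UKL => x /pP [].
have [|l [Ll fl _]] := @ultra_weak_lim _ U (snd \o p) L UU cL.
  by apply: filterS UKL => x /pP [].
exists (k + a *: l); split; first by exists k => //; exists l.
apply/weak_cvg1P => f bf; rewrite (blinD bf) (blinZ bf).
have : f (p x).1 + a * f (p x).2 @[x --> U] --> f k + a * f l.
  by apply: cvgD; [exact: fk|apply: cvgMr; exact: fl].
apply: cvg_trans; apply: near_eq_cvg.
apply: filterS UKL => x /pP [_ _ /(congr1 f)].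
by rewrite (blinD bf) (blinZ bf) => ->.
Qed.

End WeakSequences.

(** * Balls and closures of rationally convex sets *)

Section ConvexClosure.
Context {R : realType} {E : normedModType R}.

Lemma closed_norm_le r : closed [set x : E | `|x| <= r].
Proof.
rewrite (_ : [set x | _] = (fun x : E => `|x|) @^-1` [set s | s <= r])//.
by apply: closed_comp; [move=> x _; exact: norm_continuous|exact: closed_le].
Qed.

Lemma cvx_norm_le r : cvx [set x : E | `|x| <= r].
Proof.
move=> t x y t0 t1 /= xr yr; apply: le_trans (ler_normD _ _) _.
rewrite !normrZ !ger0_norm ?subr_ge0//.
have -> : r = t * r + (1 - t) * r by rewrite -mulrDl addrC subrK mul1r.
by apply: lerD; rewrite ler_wpM2l ?subr_ge0.
Qed.

Lemma closure_cvx (C : set E) : (forall q (x y : E), 0 <= q -> q <= 1 :> rat ->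
    C x -> C y -> C (ratr q *: x + (1 - ratr q) *: y)) -> cvx (closure C).
Proof.
move=> cC.
have closureP x : closure C x <-> forall e, 0 < e -> exists2 y, C y & `|x - y| < e.
  split=> [clx e e0|H B /nbhs_normP [e e0 eB]].
    by have [y [Cy xy]] := clx _ (nbhsx_ballx x e e0); exists y; rewrite // -ball_normE in xy.
  by have [y Cy xy] := H _ e0; exists y; split=> //; exact: eB.
move=> t x y t0 t1 clx cly.
have [->|tn0] := eqVneq t 0; first by rewrite scale0r add0r subr0 scale1r.
have [->|tn1] := eqVneq t 1; first by rewrite scale1r subrr scale0r addr0.
apply/closureP => e e0.
(* [n] bounds the norm of [x - y], so replacing [t] by a rational within [e / (2 * n)] below it
   costs at most [e / 2]. *)
pose n := `|x| + `|y| + 1.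
have n0 : 0 < n by rewrite ltr_wpDl ?addr_ge0.
have [|q] := @rat_in_itvoo _ (Num.max 0 (t - e / (2 * n))) t.
  rewrite gt_max lt_neqAle eq_sym tn0 t0/=.
  by rewrite ltrBlDr ltrDl divr_gt0 ?mulr_gt0.
rewrite in_itv/= gt_max => /andP[/andP[q0 tq] qt].
have /closureP/(_ (e / 2)) [|x' Cx' xx'] := clx; first by rewrite divr_gt0.
have /closureP/(_ (e / 2)) [|y' Cy' yy'] := cly; first by rewrite divr_gt0.
exists (ratr q *: x' + (1 - ratr q) *: y').
  apply: cC => //; first by rewrite -(ler_rat R) rmorph0 ltW.
  by rewrite -(ler_rat R) rmorph1; exact: le_trans (ltW qt) t1.
have -> : t *: x + (1 - t) *: y - (ratr q *: x' + (1 - ratr q) *: y') =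
    (t - ratr q) *: (x - y) + (ratr q *: (x - x') + (1 - ratr q) *: (y - y')).
  apply: blin_separates => f bf.
  by rewrite !(blinB bf, blinD bf, blinZ bf); ring.
have q1 : 0 < 1 - ratr q :> R by lra.
apply: le_lt_trans (ler_normD _ _) _.
have : `|ratr q *: (x - x') + (1 - ratr q) *: (y - y')| < e / 2.
  apply: le_lt_trans (ler_normD _ _) _.
  rewrite normrZ [X in _ + X]normrZ (gtr0_norm q0) (gtr0_norm q1).
  have := ltr_pM2l q0 `|x - x'| (e / 2); have := ltr_pM2l q1 `|y - y'| (e / 2).
  rewrite xx' yy'; move: (ratr q) => r; lra.
have : `|(t - ratr q) *: (x - y)| <= e / 2.
  rewrite normrZ gtr0_norm ?subr_gt0//.
  apply: (@le_trans _ _ (e / (2 * n) * n)).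
    apply: ler_pM => //; first by rewrite subr_ge0 ltW.
      by move: tq; move: (ratr q) (e / (2 * n)) => r d; lra.
    by apply: le_trans (ler_normB _ _) _; rewrite lerDl.
  by rewrite invfM mulrA divfK// gt_eqF.
lra.
Qed.

End ConvexClosure.

(** * Separability and subsequences *)

Section Separable.
Context {R : realType} {E : normedModType R}.

Definition mix (q : rat) (x y : E) : E := ratr q *: x + (1 - ratr q) *: y.

(* Terms generating the smallest set that contains [a], and is closed under [g]
   and under convex combinations with rational weights. *)
Fixpoint term_eval (a : nat -> E) (g : E -> E) (t : GenTree.tree (nat + rat)) : E :=
  match t with
  | GenTree.Leaf (inl n) => a n
  | GenTree.Node 0 [:: t1] => g (term_eval a g t1)
  | GenTree.Node 1 [:: GenTree.Leaf (inr q); t1; t2] =>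
      if (0 <= q) && (q <= 1) then mix q (term_eval a g t1) (term_eval a g t2)
      else a 0%N
  | _ => a 0%N
  end.

(** Terms are countable, so the generated set is the range of a sequence. The last clause is
    induction on terms, with [g] applied only at points already in [range D]. *)
Lemma rational_hull (a : nat -> E) (g : E -> E) : exists D : nat -> E,
  [/\ forall i, range D (a i), forall x, range D x -> range D (g x),
      forall q (x y : E), 0 <= q -> q <= 1 -> range D x -> range D y ->
        range D (mix q x y) &
      forall P : set E, (forall i, P (a i)) ->
        (forall x, range D x -> P x -> P (g x)) ->
        (forall q (x y : E), 0 <= q -> q <= 1 -> P x -> P y -> P (mix q x y)) ->
        range D `<=` P].
Proof.
pose D n := if @unpickle (GenTree.tree (nat + rat)) n is Some t then term_eval a g t else a 0%N.
have Dt t : range D (term_eval a g t) by exists (pickle t) => //; rewrite /D pickleK.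
have DE x : range D x -> exists t, x = term_eval a g t.
  move=> [n _ <-]; rewrite /D; case: unpickle => [t|]; first by exists t.
  by exists (GenTree.Leaf (inl 0%N)).
exists D; split.
- by move=> i; have := Dt (GenTree.Leaf (inl i)).
- by move=> x /DE [t ->]; exact: (Dt (GenTree.Node 0 [:: t])).
- move=> q x y q0 q1 /DE [t ->] /DE [u ->].
  by have := Dt (GenTree.Node 1 [:: GenTree.Leaf (inr q); t; u]); rewrite /= q0 q1.
- move=> P Pa Pg Pmix x /DE [t ->] {x}.
  move: t; fix IH 1; case=> [[n|q]|n l] /=; [exact: Pa|exact: Pa|].
  case: n => [|[|n]]; last exact: Pa.
    case: l => [|t [|? ?]]; [exact: Pa| |exact: Pa].
    by apply: Pg; [exact: Dt|exact: IH].
  case: l => [|[[n|q]|? ?] [|t [|u [|? ?]]]]; try exact: Pa.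
  case: ifP => [/andP[q0 q1]|_]; last exact: Pa.
  by apply: Pmix => //; exact: IH.
Qed.

Lemma cvx_mix (C : set E) q (x y : E) : cvx C -> 0 <= q -> q <= 1 -> C x -> C y -> C (mix q x y).
Proof.
move=> cC q0 q1 Cx Cy; apply: cC => //; first by rewrite ler0q.
by rewrite -(rmorph1 (@ratr R)) ler_rat.
Qed.

(** Norming functionals of the countably many differences [D i - D j] suffice, since [x - y] is
    approximated by such differences. *)
Lemma separating_sequence (D : nat -> E) : exists f : nat -> E -> R,
  (forall j, blin 1 (f j)) /\ forall x y, closure (range D) x -> closure (range D) y ->
    (forall j, f j x = f j y) -> x = y.
Proof.
have /choice[h hP] (ij : nat * nat) : exists f : E -> R, blin 1 f /\
    f (D ij.1 - D ij.2) = `|D ij.1 - D ij.2|.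
  by have [f] := norming (D ij.1 - D ij.2); exists f.
exists (fun n => h (odflt (0%N, 0%N) (unpickle n))).
split=> [j|x y Dx Dy hxy]; first exact: (hP _).1.
have {}hxy ij : h ij (x - y) = 0.
  have := hxy (pickle ij); rewrite pickleK/= => e.
  by rewrite (blinB (hP ij).1) e subrr.
apply/eqP; rewrite -subr_eq0 -normr_le0; apply/ler_addgt0Pr => e e0; rewrite add0r.
have e40 : 0 < e / 4 by rewrite divr_gt0.
have [_ [[i _ <-]]] := Dx _ (nbhsx_ballx x _ e40); rewrite -ball_normE/= => xi.
have [_ [[j _ <-]]] := Dy _ (nbhsx_ballx y _ e40); rewrite -ball_normE/= => yj.
have e1 : x - y - (D i - D j) = (x - D i) - (y - D j).
  by apply: blin_separates => f bf; rewrite !(blinB bf); ring.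
have [bh hn] := hP (i, j); have := hxy (i, j).
have := blin_bound bh ((x - y) - (D i - D j)); rewrite mul1r (blinB bh _ (D i - D j)).
move=> + h0; rewrite h0 sub0r normrN /= hn normr_id => le1.
have := ler_normB (x - D i) (y - D j).
have := ler_normD (x - y - (D i - D j)) (D i - D j); rewrite subrK.
rewrite e1 in le1 *; lra.
Qed.

End Separable.

(** * Weakly convergent subsequences in weakly compact sets *)

Section Eberlein.
Context {R : realType} {E : normedModType R}.

(** Compactness gives weak limits along ultrafilters, and the separating [f j] identify each of them
    with [l]. *)
Lemma weak_cvg_of_separating (K C : set E) (f : nat -> E -> R) (x : nat -> E) (l : E) :
  weakly_compact K -> closed C -> cvx C ->
  (forall x y, C x -> C y -> (forall j, f j x = f j y) -> x = y) ->
  (forall j, blin 1 (f j)) -> (forall n, K (x n)) -> (forall n, C (x n)) -> C l ->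
  (forall j, f j (x n) @[n --> \oo] --> f j l) -> weak_cvg x l.
Proof.
move=> cK clC cC sepf bf Kx Cx Cl fx; apply/weak_cvg_seqP => g bg.
apply/cvgrPdist_lt => e e0; apply: contrapT => ne.
have [N|U [UU sU UP]] := @infinitely_often_ultra [set n | e <= `|g l - g (x n)|].
  apply: contrapT => nN; apply: ne; exists N => // m /= Nm.
  by rewrite ltNge; apply/negP => vm; apply: nN; exists m.
have [|k [Kk fk Ck]] := @ultra_weak_lim _ _ _ U x K UU cK; first exact: filterE.
have kl : k = l.
  apply: sepf => // [|j]; first by apply: Ck => //; exact: filterE.
  have : f j (x n) @[n --> U] --> f j l by apply: cvg_trans (fx j); exact: cvg_app.
  by move=> /(cvg_unique (@norm_hausdorff _ R^o)) /(_ (fk _ (bf j))).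
have /cvgrPdist_lt /(_ _ e0) gU := fk _ bg.
have [n [/= n1 n2]] := filter_ex (filterI UP gU).
by move: n2; rewrite kl ltNge n1.
Qed.

(** The sequential half of the Eberlein-Smulian theorem. The terms lie in a separable closed convex
    set, where countably many functionals separate points; a diagonal subsequence converges under
    each of them. *)
Lemma weakly_compact_subseq (K : set E) (x : nat -> E) : weakly_compact K ->
  (forall n, K (x n)) ->
  exists phi, increasing_seq phi /\ exists2 l, K l & weak_cvg (x \o phi) l.
Proof.
move=> cK Kx.
have [D [Dx _ Dmix _]] := rational_hull x id.
pose C := closure (range D).
have clC : closed C by exact: closed_closure.
have cC : cvx C by apply: closure_cvx => q u v q0 q1; exact: Dmix.
have Cx n : C (x n) by apply: subset_closure.
have [f [bf sepf]] := separating_sequence D.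
have [U [UU sU _]] : exists U, [/\ UltraFilter U, \oo `<=` U & U [set: nat]].
  by apply: infinitely_often_ultra => N; exists N.
have [|l [Kl fl Cl]] := @ultra_weak_lim _ _ _ U x K UU cK; first exact: filterE.
have {}Cl : C l by apply: Cl => //; exact: filterE.
have [eps [eps0 epsP]] := null_sequence R.
have [|phi [ip phiP]] := @choose_subseq (fun k m =>
    forall i, (i <= k)%N -> `|f i l - f i (x m)| < eps k).
  move=> k N.
  have : U [set m | forall i, (i < k.+1)%N -> `|f i l - f i (x m)| < eps k].
    elim: k.+1 => [|j IH]; first by apply: filterE.
    have /cvgrPdist_lt /(_ _ (eps0 k)) jU := fl _ (bf j).
    apply: filterS (filterI IH jU) => m [/= m1 m2] i.
    by rewrite ltnS leq_eqVlt => /orP[/eqP ->|/m1].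
  have NU : U [set m | (N <= m)%N] by apply: sU; exists N.
  by move=> /(filterI NU) /filter_ex [m [Nm mP]]; exists m.
exists phi; split=> //; exists l => //.
apply: (weak_cvg_of_separating cK clC cC sepf bf) => // [n|n|j]; [exact: Kx|exact: Cx|].
apply/cvgrPdist_lt => d d0; have [N _ NP] := epsP _ d0.
exists (maxn N j) => // k /=; rewrite geq_max => /andP[Nk jk].
exact: lt_trans (phiP _ _ jk) (NP _ Nk).
Qed.

End Eberlein.

(** * Fixed points *)

Section AlmostFixed.
Context {R : realType} {V : lmodType R}.

(** Points of weight 0 may lie outside [C]; thus a grid point is placed in the hull of its own
    support. *)
Lemma cvx_sum (C : set V) (I : eqType) (r : seq I) (t : I -> R) (q : I -> V) :
  cvx C -> (forall i, 0 <= t i) -> (forall i, i \in r -> t i != 0 -> C (q i)) ->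
  0 < \sum_(i <- r) t i ->
  C ((\sum_(i <- r) t i)^-1 *: \sum_(i <- r) t i *: q i).
Proof.
move=> cC t0; elim: r => [|i r IH] Cq; first by rewrite big_nil ltxx.
have Cq' j : j \in r -> t j != 0 -> C (q j).
  by move=> jr; apply: Cq; rewrite inE jr orbT.
rewrite !big_cons; set T := \sum_(j <- r) t j; set Q := \sum_(j <- r) _.
have T0 : 0 <= T by exact: sumr_ge0.
have [ti0|ti0] := eqVneq (t i) 0.
  by rewrite ti0 scale0r !add0r; exact: IH.
have Ci : C (q i) by apply: Cq; rewrite ?inE ?eqxx.
have ti : 0 < t i by rewrite lt_neqAle eq_sym ti0 t0.
move: T0; rewrite le_eqVlt => /orP[/eqP T0|T0] _.
  have Q0 : Q = 0.
    rewrite /Q big_seq big1// => j jr.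
    have /eqP := esym T0; rewrite /T psumr_eq0// => /allP/(_ _ jr)/= /eqP ->.
    by rewrite scale0r.
  by rewrite -T0 Q0 !addr0 scalerA mulVf// scale1r.
have TT : 0 < t i + T by rewrite addr_gt0.
have e1 : 1 - t i / (t i + T) = T / (t i + T).
  by rewrite -[1](@divff _ (t i + T)) ?gt_eqF// -mulrBl addrC addKr.
have -> : (t i + T)^-1 *: (t i *: q i + Q) =
    (t i / (t i + T)) *: q i + (1 - t i / (t i + T)) *: (T^-1 *: Q).
  by rewrite e1 scalerDr !scalerA mulrAC divff ?gt_eqF// mul1r [_ * t i]mulrC.
apply: cC => //; last exact: IH.
  by rewrite mulr_ge0// ?invr_ge0 ltW.
by rewrite ler_pdivrMr// mul1r lerDl ltW.
Qed.

Variables (rho : V -> R).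
Hypothesis rhoD : forall x y, rho (x + y) <= rho x + rho y.
Hypothesis rhoZ : forall a x, rho (a *: x) = `|a| * rho x.

Lemma rho_sum (I : Type) (r : seq I) (P : pred I) (F : I -> V) :
  rho (\sum_(i <- r | P i) F i) <= \sum_(i <- r | P i) rho (F i).
Proof.
elim/big_rec2 : _ => [|i a b _ ba]; first by rewrite -(scale0r 0) rhoZ normr0 mul0r.
by apply: le_trans (rhoD _ _) _; rewrite lerD2l.
Qed.

(** Here [q i] plays the value of a map at [p i]. Each point of a fine barycentric grid over the
    [q i] is labelled by the index of a nearby [p i]; the grid lemma yields a point near which every
    index of its support occurs as a label. *)
Lemma almost_fixed (n : nat) (p q : 'I_n.+1 -> V) B d : 0 < d ->
  (forall i j, rho (q i - q j) <= B) ->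
  (forall x, hull (range q) x -> exists i, rho (x - p i) < d) ->
  exists x, hull [set q i | i in [set i | rho (x - p i) < d + d]] x.
Proof.
move=> d0 qB cover.
have rho0 : rho 0 = 0 by rewrite -(scale0r 0) rhoZ normr0 mul0r.
have B0 : 0 <= B by have := qB ord0 ord0; rewrite subrr rho0.
(* Mesh size: weights are multiples of [1 / N.+1], and the grid lemma allows a displacement of
   [n.+1] units. *)
have [N0 BN] : exists N : nat, n.+1%:R * B / N.+1%:R < d.
  have B1 : 0 < n.+1%:R * B + 1 by rewrite ltr_wpDl// mulr_ge0.
  have [N] := filter_ex (near_infty_natSinv_lt (PosNum (divr_gt0 d0 B1))).
  rewrite /= ltr_pdivlMr// => NP; exists N; apply: le_lt_trans NP.
  by rewrite mulrC ler_wpM2l// ?invr_ge0// lerDl.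
pose N := N0.+1.
pose wt (w : 'I_n.+1 -> nat) := \sum_i (w i)%:R / N%:R *: q i.
have N0' : N%:R != 0 :> R by rewrite pnatr_eq0.
have sumw (w : 'I_n.+1 -> nat) : (\sum_i w i = N)%N -> \sum_i (w i)%:R / N%:R = 1 :> R.
  by move=> wN; rewrite -mulr_suml -natr_sum wN divff.
have wt_hull (w : 'I_n.+1 -> nat) (A : set V) : (forall i, w i != 0%N -> A (q i)) ->
    (\sum_i w i = N)%N -> hull A (wt w).
  move=> wA wN.
  have := @cvx_sum (hull A) _ (index_enum 'I_n.+1) (fun i => (w i)%:R / N%:R) q
    (@hull_cvx _ _ A).
  rewrite (sumw _ wN) invr1 scale1r; apply => // i _.
  rewrite mulf_eq0 negb_or pnatr_eq0 => /andP[wi _].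
  by apply: sub_hull; exact: wA.
have /choice[c cP] (a : {ffun 'I_n.+1 -> 'I_N.+1}) : exists i : 'I_n.+1,
    (\sum_i a i = N)%N -> rho (wt (fun i => a i) - p i) < d.
  have [aN|/eqP aN] := eqVneq (\sum_i a i)%N N; last by exists ord0.
  have [|i ip] := cover (wt (fun i => a i)); last by exists i.
  by apply: wt_hull => // i _; exists i.
have [w [J [j0 [j0J wN wJ HJ]]]] := grid_labelling ord0 c.
exists (wt w); apply: wt_hull => // i wi; exists i => //=.
have iJ : i \in J by apply: contraNT wi => /wJ ->.
have [a [ca aN wa wj0]] := HJ _ iJ.
have := cP a aN; rewrite ca => pa.
(* Measuring from [q j0] removes the coordinate [j0], the only one where [w] may exceed [a]. *)
have wtE : wt w - wt (fun k => a k) =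
    \sum_k (((w k)%:R - (a k)%:R) / N%:R) *: (q k - q j0).
  rewrite /wt -sumrB.
  have s0 : \sum_k (((w k)%:R - (a k)%:R) / N%:R) = 0 :> R.
    by rewrite -mulr_suml sumrB -!natr_sum wN aN subrr mul0r.
  under [RHS]eq_bigr do rewrite scalerBr.
  rewrite [RHS]sumrB -scaler_suml s0 scale0r subr0.
  by apply: eq_bigr => k _; rewrite -scalerBl -mulrBl.
suff wa_small : rho (wt w - wt (fun k => a k)) < d.
  have -> : wt w - p i = (wt w - wt (fun k => a k)) + (wt (fun k => a k) - p i).
    by rewrite addrA subrK.
  exact: le_lt_trans (rhoD _ _) (ltrD wa_small pa).
rewrite wtE; apply: le_lt_trans (rho_sum _ _ _) _; apply: le_lt_trans BN.
rewrite (bigD1 j0)//= subrr scaler0 rho0 add0r.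
apply: (@le_trans _ _ (\sum_(k | k != j0) ((a k)%:R - (w k)%:R) / N%:R * B)).
  apply: ler_sum => k kj; have wak : (w k)%:R <= (a k)%:R :> R by rewrite ler_nat wa.
  have -> : ((a k)%:R - (w k)%:R) / N%:R = `|((w k)%:R - (a k)%:R) / N%:R| :> R.
    by rewrite normrM normfV normr_nat distrC ger0_norm// subr_ge0.
  by rewrite rhoZ ler_wpM2l.
rewrite -mulr_suml -mulr_suml sumrB -!natr_sum mulrAC.
rewrite ler_wpM2r ?invr_ge0// ler_wpM2r// lerBlDr -natrD ler_nat.
move: wN aN; rewrite (bigD1 j0)//= [in X in _ -> X -> _](bigD1 j0)//= => wN aN.
rewrite -(leq_add2l (nat_of_ord (a j0))).
apply: (@leq_trans (w j0 + \sum_(k | k != j0) w k)%N); first by rewrite aN wN.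
rewrite addnA leq_add2r; apply: leq_trans wj0 _.
by rewrite leq_add2l card_ord.
Qed.

End AlmostFixed.

(** * Kakutani's theorem for the weak topology *)

Section WeakFixedPoint.
Context {R : realType} {E : normedModType R}.

Section PartialSeminorm.
Variable f : nat -> E -> R.
Hypothesis bf : forall j, blin 1 (f j).

Definition rho k (x : E) : R := \sum_(j < k) `|f j x|.

Lemma rhoD k x y : rho k (x + y) <= rho k x + rho k y.
Proof.
rewrite /rho -big_split /=; apply: ler_sum => j _.
by rewrite (blinD (bf j)) ler_normD.
Qed.

Lemma rhoZ k a x : rho k (a *: x) = `|a| * rho k x.
Proof.
rewrite /rho mulr_sumr; apply: eq_bigr => j _.
by rewrite (blinZ (bf j)) normrM.
Qed.

Lemma rhoN k x : rho k (- x) = rho k x.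
Proof. by rewrite -scaleN1r rhoZ normrN1 mul1r. Qed.

Lemma rho_le k x : rho k x <= k%:R * `|x|.
Proof.
apply: (@le_trans _ _ (\sum_(j < k) `|x|)); last first.
  by rewrite sumr_const card_ord mulr_natl.
by apply: ler_sum => j _; have := blin_bound (bf j) x; rewrite mul1r.
Qed.

Lemma le_rho k j x : (j < k)%N -> `|f j x| <= rho k x.
Proof.
move=> jk; rewrite /rho (bigD1 (Ordinal jk))//= lerDl.
exact: sumr_ge0.
Qed.

Lemma weak_cvg_rho k (x : nat -> E) l e : 0 < e -> weak_cvg x l ->
  \forall n \near \oo, rho k (x n - l) < e.
Proof.
move=> e0 xl; have /weak_cvg_seqP x0 := weak_cvgB xl (@weak_cvg_cst _ _ l).
suff : rho k (x n - l) @[n --> \oo] --> (0 : R) by move/cvgr_lt; apply.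
rewrite /rho; elim: k => [|k IH].
  by under eq_fun do rewrite big_ord0; exact: cvg_cst.
have := cvgD IH (cvg_norm (x0 _ (bf k))); rewrite subrr (blin0 (bf k)) normr0.
rewrite addr0 => cv; under eq_fun do rewrite big_ord_recr /=.
exact: cv.
Qed.

(** An [e]-separated list that cannot be extended is a net. If every list could be extended, [K]
    would contain an infinite [e]-separated sequence, against weak sequential compactness. *)
Lemma finite_net (K : set E) k e : 0 < e -> weakly_compact K -> K !=set0 ->
  exists n (p : 'I_n.+1 -> E), (forall i, K (p i)) /\
    forall x, K x -> exists i, rho k (x - p i) < e.
Proof.
move=> e0 cK [x0 Kx0].
pose Q (s : seq E) t := K t /\ forall i, (i < size s)%N -> e <= rho k (t - nth 0 s i).
have [[s [sv sn]]|ns] := pselect (exists s,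
    (forall i, (i < size s)%N -> Q (take i s) (nth 0 s i)) /\ ~ exists t, Q s t).
  case: s sv sn => [|y s] sv sn; first by case: sn; exists x0.
  exists (size s), (fun i => nth 0 (y :: s) i); split.
    by move=> i; have [] := sv i (ltn_ord i).
  move=> x Kx; apply: contrapT => nx; apply: sn; exists x; split=> // i si.
  by rewrite leNgt; apply/negP => lt; apply: nx; exists (Ordinal si).
have [s sv|x xP] := @sequence_by_prefix _ Q 0.
  by apply: contrapT => nt; apply: ns; exists s.
have [phi [ip [l Kl xl]]] := weakly_compact_subseq cK (fun n => (xP n).1).
have e20 : 0 < e / 2 by rewrite divr_gt0.
have [N _ NP] := weak_cvg_rho k e20 xl.
have lt : (phi N < phi N.+1)%N by move/increasing_seqP: ip; exact.
have [_ /(_ (phi N))] := xP (phi N.+1); rewrite size_mkseq nth_mkseq// => /(_ lt).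
have := NP N (leqnn N); have := NP N.+1 (leqnSn N).
have := rhoD k (x (phi N.+1) - l) (- (x (phi N) - l)).
rewrite rhoN opprB addrA subrK /=; lra.
Qed.

End PartialSeminorm.

(* A sequence of functionals separating [K] metrizes its weak topology, which
   makes sequential closedness of the graph sufficient in Kakutani's argument. *)
Theorem weak_fixed_point (D : nat -> E) M (H : E -> set E) :
  let K := closure (range D) in
  cvx K -> weakly_compact K -> (forall x, K x -> `|x| <= M) ->
  (forall x, K x -> H x !=set0 /\ H x `<=` K) ->
  (forall x, K x -> cvx (H x)) -> weakly_seq_closed_graph K H ->
  exists2 x, K x & H x x.
Proof.
move=> K cK wK KM HK cH Hgraph.
have clK : closed K by exact: closed_closure.
have [f [bf sepf]] := separating_sequence D.
have [eps [eps0 epsP]] := null_sequence R.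
have /choice[h hP] (x : E) : exists y, K x -> H x y.
  by have [/HK [[y Hy] _]|nK] := pselect (K x); [exists y|exists 0].
have hK x : K x -> K (h x) by move=> Kx; apply: (HK x Kx).2; exact: hP.
have K0 : K !=set0 by exists (D 0%N); apply: subset_closure; exists 0%N.
have /choice[x xP] k : exists x, K x /\
    hull [set h p | p in [set p | K p /\ rho f k (x - p) < eps k]] x.
  have e20 : 0 < eps k / 2 by rewrite divr_gt0.
  have [n [p [Kp pnet]]] := finite_net bf k e20 wK K0.
  have hpK : range (h \o p) `<=` K by move=> _ [i _ <-]; exact/hK/Kp.
  have [i j||x hx] := @almost_fixed _ _ (rho f k) (rhoD bf k) (rhoZ bf k) n p (h \o p)
      (k%:R * (M + M)) (eps k / 2) e20.
  - apply: le_trans (rho_le bf _ _) _; rewrite ler_wpM2l//.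
    apply: le_trans (ler_normB _ _) _.
    by rewrite lerD//; apply: KM; apply: hpK; [exists i|exists j].
  - by move=> x /(hull_min cK hpK); exact: pnet.
  exists x; split; first by apply: (hull_min cK _ hx) => _ [i _ <-]; apply: hpK; exists i.
  apply: hullS hx => _ [i /= ri <-]; exists (p i) => //.
  by split=> //; move: ri; rewrite -splitr.
have [phi [ip [l Kl xl]]] := weakly_compact_subseq wK (fun n => (xP n).1).
exists l => //; apply: contrapT => nHl.
(* The graph condition at the constant sequence [l] makes [H l] norm closed, so [l] has positive
   distance from it. *)
have [r r0 rP] : exists2 r, 0 < r & forall y, H l y -> r <= `|l - y|.
  apply: contrapT => nr.
  have /choice[y yP] n : exists y, H l y /\ `|l - y| < eps n.
    apply: contrapT => ny; apply: nr; exists (eps n) => // y Hy.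
    by rewrite leNgt; apply/negP => lt; apply: ny; exists y.
  apply: nHl; apply: (Hgraph (fun=> l) y l l) => //.
  - exact: weak_cvg_cst.
  - by move=> n; exact: (yP n).1.
  apply: cvg_weak_cvg; apply/cvgrPdist_lt => e e0; apply: filterS (epsP _ e0) => n.
  exact: lt_trans (yP n).2.
have [g bg gP] := separation (cH _ Kl) rP.
have r20 : 0 < r / 2 by rewrite divr_gt0.
have [N _ NP] : \forall n \near \oo, g l - r / 2 < g (x (phi n)).
  have /weak_cvg_seqP /(_ _ bg) gx := xl.
  by apply: (cvgr_gt _ gx); rewrite ltrBlDr ltrDl.
pose th n := phi (N + n)%N.
have ith : increasing_seq th.
  apply: (increasing_seq_comp ip (psi := fun n => (N + n)%N)).
  by apply/increasing_seqP => n; rewrite addnS; exact: ltnSn.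
have xth : weak_cvg (x \o th) l.
  apply: (weak_cvg_subseq (phi := fun n => (N + n)%N)) xl.
  by apply/increasing_seqP => n; rewrite addnS; exact: ltnSn.
(* [x (th n)] is a convex combination of values [h q] at nearby [q], so one of these values reaches
   the level [g l - r / 2]. In the limit this contradicts the gap [r] between [l] and [H l]. *)
have /choice[p pP] n : exists p, [/\ K p, rho f (th n) (x (th n) - p) < eps (th n) &
    g l - r / 2 <= g (h p)].
  apply: contrapT => np; have := NP (N + n)%N (leq_addr _ _).
  rewrite /= -/(th n); apply/negP; rewrite -leNgt.
  apply: (hull_min _ _ (xP (th n)).2 : [set v : E | g v <= g l - r / 2] _).
    move=> t u v t0 t1 /= hu hv.
    by rewrite (blinD bg) !(blinZ bg); nra.
  move=> _ [q [Kq qx] <-] /=; rewrite leNgt; apply/negP => lt.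
  by apply: np; exists q; split=> //; exact: ltW.
have pl : weak_cvg p l.
  apply: (weak_cvg_of_separating wK clK cK sepf bf) => // [n|n|j]; try by have [] := pP n.
  have /weak_cvg_seqP /(_ _ (bf j)) fx := xth.
  apply/cvgrPdist_lt => e e0; have e20 : 0 < e / 2 by rewrite divr_gt0.
  have /cvgrPdist_lt /(_ _ e20) [N1 _ NP1] := fx.
  have [N2 _ NP2] := epsP _ e20.
  exists (maxn (maxn N1 N2) j.+1) => // n /=; rewrite !geq_max => /andP[/andP[n1 n2] jn].
  have jth : (j < th n)%N by apply: leq_trans jn (increasing_seq_ge n ith).
  have := le_rho f (x (th n) - p n) jth; have [_ + _] := pP n.
  have := NP1 n n1; have := NP2 (th n) (leq_trans n2 (increasing_seq_ge n ith)).
  rewrite /= (blinB (bf j)).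
  have := ler_normD (f j l - f j (x (th n))) (f j (x (th n)) - f j (p n)).
  rewrite addrA subrK; lra.
have hpK n : K (h (p n)) by apply: hK; have [] := pP n.
have [psi [ipsi [y Ky hy]]] := weakly_compact_subseq wK hpK.
have Hly : H l y.
  apply: (Hgraph (p \o psi) ((h \o p) \o psi)) => //.
  - by move=> n; have [] := pP (psi n).
  - exact: weak_cvg_subseq.
  - by move=> n; apply: hP; have [] := pP (psi n).
have : g l - r / 2 <= g y.
  have /weak_cvg_seqP /(_ _ bg) gy := hy.
  by apply: (cvgr_to_ge gy); near=> n; have [] := pP (psi n).
have := gP _ Hly; lra.
Unshelve. all: by end_near. Qed.

End WeakFixedPoint.

(** * The De Blasi measure *)

Section DeBlasi.
Context {R : realType} {E : completeNormedModType R}.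
Implicit Types W K : set E.

Lemma bounded_setP W : bounded_set W <-> exists M, forall x, W x -> `|x| <= M.
Proof.
split=> [/pinfty_ex_gt0 [M _ WM]|[M WM]]; first by exists M => x /WM.
exists M; split=> [|r Mr x /WM]; first exact: num_real.
by move=> xM; exact: le_trans xM (ltW Mr).
Qed.

Definition near_compact W e := 0 < e /\ exists K, weakly_compact K /\
  W `<=` [set k + b | k in K & b in closed_ball (0 : E) e].

Lemma near_compact_has_inf W : bounded_set W -> has_inf (near_compact W).
Proof.
move=> /bounded_setP[M WM]; split; last by exists 0 => e [/ltW].
exists (`|M| + 1); have M0 : 0 < `|M| + 1 by rewrite ltr_wpDl.
split=> //; exists [set 0]; split; first exact: weakly_compact_set1.
move=> x Wx; exists 0 => //; exists x; last by rewrite add0r.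
rewrite closed_ballE// /closed_ball_ /= sub0r normrN.
by apply: le_trans (WM _ Wx) _; apply: le_trans (ler_norm M) _; rewrite lerDl.
Qed.

Lemma de_blasi_ge0 W : bounded_set W -> 0 <= de_blasi W.
Proof.
move=> /near_compact_has_inf [n0 _].
by apply: lb_le_inf => // e [/ltW].
Qed.

(** Intersecting [K] with the ball of radius [M + d] supplies [B] and keeps every [k] within [d] of
    a point of [W]. *)
Lemma de_blasi_lt W e : bounded_set W -> de_blasi W < e ->
  exists K B, [/\ weakly_compact K, forall x, K x -> `|x| <= B &
    forall x, W x -> exists2 k, K k & `|x - k| <= e].
Proof.
move=> bW We; have [M WM] := (bounded_setP W).1 bW.
have e1 : 0 < e - de_blasi W by rewrite subr_gt0.
have [d [d0 [K [cK WK]]]] := inf_adherent e1 (near_compact_has_inf bW).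
rewrite -/(de_blasi W) addrC subrK => de.
exists (K `&` [set x | `|x| <= M + d]), (M + d); split.
- by apply: weakly_compactI_closed_cvx => //; [exact: closed_norm_le|exact: cvx_norm_le].
- by move=> x [].
move=> x Wx; have [k Kk [b]] := WK _ Wx.
rewrite closed_ballE// /closed_ball_ /= sub0r normrN => bd kbx.
exists k; last by rewrite -kbx addrC addKr; exact: le_trans bd (ltW de).
split=> //=; have -> : k = x - b by rewrite -kbx addrK.
by apply: le_trans (ler_normB _ _) _; rewrite lerD// WM.
Qed.

Lemma de_blasi_le W K e : 0 < e -> weakly_compact K ->
  (forall x, W x -> exists2 k, K k & `|x - k| <= e) -> de_blasi W <= e.
Proof.
move=> e0 cK WK; apply: ge_inf; first by exists 0 => d [/ltW].
split=> //; exists K; split=> // x Wx; have [k Kk xk] := WK _ Wx.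
exists k => //; exists (x - k); last by rewrite addrC subrK.
by rewrite closed_ballE// /closed_ball_ /= sub0r normrN.
Qed.

Lemma rel_weakly_compact_sub W : rel_weakly_compact W ->
  exists2 K, weakly_compact K & W `<=` K.
Proof. by move=> [K WK [cK _]]; exists K. Qed.

Lemma cvx_closure_hull (A : set E) : cvx (closure (hull A)).
Proof.
by apply: closure_cvx => q x y q0 q1; exact: cvx_mix (@hull_cvx _ _ A) q0 q1.
Qed.

Lemma closure_norm_le (A : set E) M : (forall x, A x -> `|x| <= M) ->
  forall x, closure A x -> `|x| <= M.
Proof. by move=> AM x /(closureS AM) Ax; exact: (@closed_norm_le _ _ M x Ax). Qed.

Lemma krein_smulian K B : weakly_compact K -> (forall x, K x -> `|x| <= B) ->
  weakly_compact (closure (hull K)).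
Proof.
move=> cK KB; apply: (@weakly_compact_approx _ _ _ B).
- exact: closed_closure.
- exact: cvx_closure_hull.
- by apply: closure_norm_le; apply: hull_min => //; exact: cvx_norm_le.
move=> e e0; exists K, B; split=> // x /(_ _ (nbhsx_ballx x e e0)) [w [hw]].
by rewrite -ball_normE /= => /ltW xw; exists w.
Qed.

Lemma weakly_compact_de_blasi0 (C : set E) : bounded_set C -> cvx (closure C) ->
  de_blasi C <= 0 -> weakly_compact (closure C).
Proof.
move=> bC cC C0; have [M CM] := (bounded_setP C).1 bC.
apply: (@weakly_compact_approx _ _ _ M) => //; first exact: closed_closure.
  exact: closure_norm_le.
move=> e e0; have e20 : 0 < e / 2 by rewrite divr_gt0.
have [K [B [cK KB CK]]] := de_blasi_lt bC (le_lt_trans C0 e20).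
exists K, B; split=> // x /(_ _ (nbhsx_ballx x _ e20)) [y [Cy]].
rewrite -ball_normE /= => xy; have [k Kk yk] := CK _ Cy.
exists k; first exact: sub_hull.
rewrite -(subrK y x) -addrA; apply: le_trans (ler_normD _ _) _; lra.
Qed.

End DeBlasi.

(** * The theorem *)

Section RelaxedFixedPoint.
Context {R : realType} {E : completeNormedModType R}.
Variables (S : set E) (A B : E -> set E) (M : R) (x0 : E).
Hypothesis S_cvx : cvx S.
Hypothesis S_closed : closed S.
Hypothesis A_ncc : forall x, S x -> nonempty_closed_convex (A x).
Hypothesis B_ncc : forall x, S x -> nonempty_closed_convex (B x).
Hypothesis A_graph : weakly_seq_closed_graph S A.
Hypothesis B_graph : weakly_seq_closed_graph S B.
Hypothesis A_nonexp : countably_beta_nonexpansive S A.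
Hypothesis B_wcompact : weakly_compact_map S B.
Hypothesis AB_bounded : forall x a b, S x -> A x a -> B x b -> `|a + b| <= M.
Hypothesis AB_sub : forall x a b, S x -> A x a -> B x b -> S (a + b).
Hypothesis Sx0 : S x0.
Hypothesis x0M : `|x0| <= M.
Variable t : R.
Hypothesis t0 : 0 < t.
Hypothesis t1 : t < 1.

Definition relaxed (x : E) : set E :=
  [set y | exists a b, [/\ A x a, B x b & y = t *: (a + b) + (1 - t) *: x0]].

Lemma relaxed_nonempty x : S x -> relaxed x !=set0.
Proof.
move=> Sx; have [[a Aa] _ _] := A_ncc Sx; have [[b Bb] _ _] := B_ncc Sx.
by exists (t *: (a + b) + (1 - t) *: x0), a, b.
Qed.

Lemma relaxed_sub x : S x -> relaxed x `<=` S.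
Proof.
move=> Sx _ [a [b [Aa Bb ->]]]; apply: S_cvx (AB_sub Sx Aa Bb) Sx0; exact: ltW.
Qed.

Lemma relaxed_bound x y : S x -> relaxed x y -> `|y| <= M.
Proof.
move=> Sx [a [b [Aa Bb ->]]]; apply: (@cvx_norm_le _ E M) => //; [exact: ltW|exact: ltW|].
exact: AB_bounded Aa Bb.
Qed.

Lemma relaxed_cvx x : S x -> cvx (relaxed x).
Proof.
move=> Sx s y z s0 s1 [a [b [Aa Bb ->]]] [a' [b' [Aa' Bb' ->]]].
have [_ _ /convex_set_cvx cA] := A_ncc Sx; have [_ _ /convex_set_cvx cB] := B_ncc Sx.
exists (s *: a + (1 - s) *: a'), (s *: b + (1 - s) *: b'); split; [exact: cA|exact: cB|].
by apply: blin_separates => f bf; rewrite !(blinD bf, blinZ bf); ring.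
Qed.

(** Convergence of the sums says nothing about the summands. Weak compactness of [B] gives a
    convergent subsequence of the [b] part, and the [a] part then converges as a difference. *)
Lemma relaxed_graph (K : set E) N : K `<=` S -> (forall x, K x -> `|x| <= N) ->
  weakly_seq_closed_graph K relaxed.
Proof.
move=> KS KN x y l m Kx Kl xl Gxy ym.
have /choice[ab abP] n : exists ab : E * E, [/\ A (x n) ab.1, B (x n) ab.2 &
    y n = t *: (ab.1 + ab.2) + (1 - t) *: x0].
  by have [a [b abP]] := Gxy n; exists (a, b).
have [K2 cK2 BK2] : exists2 K2 : set E, weakly_compact K2 & mimage B (range x) `<=` K2.
  apply/rel_weakly_compact_sub/B_wcompact; first by move=> _ [n _ <-]; exact: KS.
  by apply/bounded_setP; exists N => _ [n _ <-]; exact: KN.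
have K2b n : K2 (ab n).2.
  by apply: BK2; exists (x n); [exists n|have [] := abP n].
have [phi [ip [b _ bl]]] := weakly_compact_subseq cK2 K2b.
pose a' n := t^-1 *: (y (phi n) - (1 - t) *: x0) - (ab (phi n)).2.
have a'E n : a' n = (ab (phi n)).1.
  have [_ _ yE] := abP (phi n); rewrite /a' yE addrK scalerA mulVf ?gt_eqF//.
  by rewrite scale1r addrK.
have yphi := weak_cvg_subseq ip ym.
have a'l : weak_cvg a' (t^-1 *: (m - (1 - t) *: x0) - b).
  apply: weak_cvgB bl; apply: weak_cvgZ; apply: weak_cvgB yphi _.
  exact: weak_cvg_cst.
have xphi := weak_cvg_subseq ip xl.
exists (t^-1 *: (m - (1 - t) *: x0) - b), b; split.
- apply: (A_graph _ _ xphi _ a'l) => [n||n]; [exact: (KS _ (Kx _))|exact: KS|].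
  by rewrite a'E; have [] := abP (phi n).
- apply: (B_graph _ _ xphi _ bl) => [n||n]; [exact: (KS _ (Kx _))|exact: KS|].
  by have [] := abP (phi n).
- by rewrite subrK scalerA mulfV ?gt_eqF// scale1r subrK.
Qed.

(* [de_blasi C <= t * de_blasi C], as convex hulls do not increase the measure. *)
Lemma relaxed_de_blasi (C : set E) (g : E -> E) : C `<=` S -> bounded_set C ->
  countable C -> (forall x, C x -> relaxed x (g x)) ->
  C `<=` hull (x0 |` (g @` C)) -> de_blasi C <= 0.
Proof.
move=> CS bC ctC gC Chull.
have b0 := de_blasi_ge0 bC.
have [bA Anonexp] := A_nonexp; have bAC := bA _ CS bC.
have [MA MAP] := (bounded_setP _).1 bAC.
suff contr e : de_blasi C < e -> de_blasi C <= t * e.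
  have [//|C0] := leP (de_blasi C) 0.
  have lt : de_blasi C < de_blasi C / t by rewrite ltr_pdivlMr// gtr_pMr.
  (* Any value between [de_blasi C] and [de_blasi C / t] serves: [t * e] is then below
     [de_blasi C]. *)
  pose e := (de_blasi C + de_blasi C / t) / 2.
  have /contr : de_blasi C < e by rewrite /e midf_lt.
  have te : t * e < de_blasi C.
    rewrite mulrC -ltr_pdivlMr// /e; exact: (midf_lt lt).2.
  by rewrite leNgt te.
move=> Ce.
have [K1 [B1 [cK1 K1B AK1]]] := de_blasi_lt bAC (le_lt_trans (Anonexp _ CS ctC bC) Ce).
have [K2' cK2' BK2'] := rel_weakly_compact_sub (B_wcompact CS bC).
(* The radius comes from [b = (a + b) - a]; boundedness of [K3] is an input of the Krein-Smulian
   theorem. *)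
pose K2 := K2' `&` [set x | `|x| <= M + MA].
have cK2 : weakly_compact K2.
  by apply: weakly_compactI_closed_cvx => //; [exact: closed_norm_le|exact: cvx_norm_le].
pose K3 := x0 |` [set k + t *: l | k in [set (1 - t) *: x0] & l in
  [set k + 1 *: l | k in K1 & l in K2]].
have cK3 : weakly_compact K3.
  apply: weakly_compactU; first exact: weakly_compact_set1.
  apply: weakly_compact_comb; first exact: weakly_compact_set1.
  exact: weakly_compact_comb.
have K3B x : K3 x -> `|x| <= Num.max `|x0| (`|(1 - t) *: x0| + t * (B1 + (M + MA))).
  rewrite le_max => -[->|[_ -> [_ [k Kk [l [_ lM] <-]] <-]]]; first by rewrite lexx.
  apply/orP; right; apply: le_trans (ler_normD _ _) _.
  rewrite lerD2l normrZ gtr0_norm// ler_pM2l// scale1r.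
  by apply: le_trans (ler_normD _ _) _; rewrite lerD// K1B.
have te0 : 0 < t * e by rewrite mulr_gt0// (le_lt_trans b0 Ce).
apply: (de_blasi_le te0 (krein_smulian cK3 K3B)) => x /Chull.
suff : hull (x0 |` (g @` C)) `<=`
    [set y | exists2 k, closure (hull K3) k & `|y - k| <= t * e] by apply.
apply: hull_min.
  move=> s y z s0 s1 [k Kk yk] [l Kl zl].
  exists (s *: k + (1 - s) *: l); first exact: cvx_closure_hull.
  have -> : s *: y + (1 - s) *: z - (s *: k + (1 - s) *: l) = s *: (y - k) + (1 - s) *: (z - l).
    by rewrite !scalerBr opprD addrACA.
  by apply: (@cvx_norm_le _ E (t * e)).
move=> y [->|[z Cz <-]].
  exists x0; last by rewrite subrr normr0 ltW.
  by apply: subset_closure; apply: sub_hull; left.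
have [a [b [Aa Bb ->]]] := gC _ Cz.
have [k Kk ak] : exists2 k, K1 k & `|a - k| <= e by apply: AK1; exists z.
exists ((1 - t) *: x0 + t *: (k + 1 *: b)); last first.
  have -> : t *: (a + b) + (1 - t) *: x0 - ((1 - t) *: x0 + t *: (k + 1 *: b)) = t *: (a - k).
    by apply: blin_separates => f bf; rewrite !(blinB bf, blinD bf, blinZ bf); ring.
  by rewrite normrZ gtr0_norm// ler_pM2l.
apply: subset_closure; apply: sub_hull; right; exists ((1 - t) *: x0) => //.
exists (k + 1 *: b) => //; exists k => //; exists b => //; split.
  by apply: BK2'; exists z.
rewrite /= (_ : b = (a + b) - a); last by rewrite addrC addKr.
apply: le_trans (ler_normB _ _) _; apply: lerD; first exact: AB_bounded (CS _ Cz) Aa Bb.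
by apply: MAP; exists z.
Qed.

(** For [x] in [K], points [d n] of [D] tend to [x] and [g (d n)] stays in [D]; a weak limit of
    these values lies both in [relaxed x] and in [K]. The fixed point theorem therefore applies to
    the intersection of the two. *)
Lemma relaxed_fixed_point : exists u a b,
  [/\ S u, A u a, B u b & u = t *: (a + b) + (1 - t) *: x0].
Proof.
have /choice[g gP] (x : E) : exists y, S x -> relaxed x y.
  by have [/relaxed_nonempty [y Gy]|nS] := pselect (S x); [exists y|exists 0].
have [D [Dx0 Dg Dmix Dmin]] := rational_hull (fun=> x0) g.
have DS : range D `<=` S.
  apply: Dmin => // [x _ Sx|q x y q0 q1 Sx Sy]; first exact: relaxed_sub (gP _ Sx).
  exact: cvx_mix.
have DM x : range D x -> `|x| <= M.
  move: x; apply: Dmin => // [x Dx _|q x y q0 q1 xM yM].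
    exact: relaxed_bound (DS _ Dx) (gP _ (DS _ Dx)).
  exact: (cvx_mix (@cvx_norm_le _ E M)).
pose K := closure (range D).
have KS : K `<=` S.
  by move=> x /(closureS DS); exact: S_closed.
have KM : forall x, K x -> `|x| <= M := closure_norm_le DM.
have cK : cvx K by exact: closure_cvx.
have bD : bounded_set (range D) by apply/bounded_setP; exists M.
have D0 : de_blasi (range D) <= 0.
  apply: (@relaxed_de_blasi _ g) => // [|x Dx|].
  - exact: card_image_le.
  - exact/gP/DS.
  apply: Dmin.
  - by move=> _; apply: sub_hull; left.
  - by move=> x Dx _; apply: sub_hull; right; exists x.
  - by move=> q x y; exact: cvx_mix (@hull_cvx _ _ _).
have wK : weakly_compact K by exact: weakly_compact_de_blasi0.
have Ggraph := relaxed_graph KS KM.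
have [|x Kx||u Ku [[a [b [Aa Bb uE]]] _]] :=
    @weak_fixed_point _ _ D M (fun x => relaxed x `&` K) cK wK KM _ _ _.
- move=> x Kx; split; last by move=> y [].
  have [eps [eps0 epsP]] := null_sequence R.
  have /choice[d dP] n : exists y, range D y /\ `|x - y| < eps n.
    have [y [Dy]] := Kx _ (nbhsx_ballx x _ (eps0 n)).
    by rewrite -ball_normE; exists y.
  have dx : weak_cvg d x.
    apply: cvg_weak_cvg; apply/cvgrPdist_lt => e e0; apply: filterS (epsP _ e0) => n.
    exact: lt_trans (dP n).2.
  have Kg n : K (g (d n)) by apply: subset_closure; apply: Dg; exact: (dP n).1.
  have [phi [ip [y Ky gy]]] := weakly_compact_subseq wK Kg.
  exists y; split=> //; apply: (Ggraph (d \o phi) ((g \o d) \o phi)) => //.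
  + by move=> n; apply: subset_closure; exact: (dP _).1.
  + exact: weak_cvg_subseq.
  + by move=> n; apply/gP/DS; exact: (dP _).1.
- move=> s y z s0 s1 [Gy Ky] [Gz Kz]; split; last exact: cK.
  exact: relaxed_cvx (KS _ Kx) _ _ _ s0 s1 Gy Gz.
- move=> x y l m Kx Kl xl Gxy ym; split.
    by apply: (Ggraph x y) => // n; have [] := Gxy n.
  apply: (weak_lim_closed_cvx _ cK _ ym); first exact: closed_closure.
  by move=> n; have [] := Gxy n.
by exists u, a, b; split=> //; exact: KS.
Qed.

End RelaxedFixedPoint.

Theorem corollary3p4 (R : realType) (E : completeNormedModType R)
    (S : set E) (A B : E -> set E)
    (S_ncc : nonempty_closed_convex S)
    (A_ncc : forall x, S x -> nonempty_closed_convex (A x))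
    (B_ncc : forall x, S x -> nonempty_closed_convex (B x))
    (A_graph : weakly_seq_closed_graph S A)
    (B_graph : weakly_seq_closed_graph S B)
    (A_hemi : hemi_weakly_compact S A)
    (A_nonexp : countably_beta_nonexpansive S A)
    (B_wcompact : weakly_compact_map S B)
    (AB_bounded : bounded_set (mimage (madd A B) S))
    (AB_sub : mimage (madd A B) S `<=` S) :
  exists2 u : E, S u & madd A B u u.
Proof.
have [[x0 Sx0] S_closed /convex_set_cvx S_cvx] := S_ncc.
have [M0 M0P] := (bounded_setP _).1 AB_bounded.
pose M := Num.max M0 `|x0|.
have x0M : `|x0| <= M by rewrite le_max lexx orbT.
have ABm x a b : S x -> A x a -> B x b -> mimage (madd A B) S (a + b).
  by move=> Sx Aa Bb; exists x => //; exists a => //; exists b.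
have ABM x a b : S x -> A x a -> B x b -> `|a + b| <= M.
  by move=> Sx Aa Bb; rewrite le_max M0P//; exact: ABm Sx Aa Bb.
have [eps [eps0 epsP]] := null_sequence R.
(* Lies strictly between 0 and 1 and below [eps n]; the relaxation factor is [1 - s n]. *)
pose s n := eps n / (1 + eps n).
have e1 n : 0 < 1 + eps n by rewrite addr_gt0.
have s0 n : 0 < s n by rewrite divr_gt0.
have s1 n : s n < 1 by rewrite ltr_pdivrMr// mul1r ltrDr.
have se n : s n < eps n by rewrite ltr_pdivrMr// mulrDr mulr1 ltrDl mulr_gt0.
have /choice[u] n : exists u : E * E * E, [/\ S u.1.1, A u.1.1 u.1.2, B u.1.1 u.2 &
    u.1.1 = (1 - s n) *: (u.1.2 + u.2) + (1 - (1 - s n)) *: x0].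
  have t0 : 0 < 1 - s n by rewrite subr_gt0.
  have t1 : 1 - s n < 1 by rewrite ltrBlDr ltrDl.
  have [u [a [b uP]]] := relaxed_fixed_point S_cvx S_closed A_ncc B_ncc A_graph B_graph
    A_nonexp B_wcompact ABM (fun x a b Sx Aa Bb => AB_sub _ (ABm x a b Sx Aa Bb)) Sx0 x0M t0 t1.
  by exists (u, a, b).
pose x n := (u n).1.1; pose a n := (u n).1.2; pose b n := (u n).2.
move=> uP.
have Sx n : S (x n) by have [] := uP n.
have Aa n : A (x n) (a n) by have [] := uP n.
have Bb n : B (x n) (b n) by have [] := uP n.
have xE n : x n - a n = b n + s n *: (x0 - (a n + b n)).
  have [_ _ _ uE] := uP n.
  rewrite (uE : x n = (1 - s n) *: (a n + b n) + (1 - (1 - s n)) *: x0).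
  by apply: blin_separates => f bf; rewrite !(blinD bf, blinN bf, blinZ bf); ring.
have xM n : `|x n| <= M.
  have [_ _ _ uE] := uP n.
  rewrite (uE : x n = (1 - s n) *: (a n + b n) + (1 - (1 - s n)) *: x0).
  apply: (@cvx_norm_le _ E M) => //.
  - by rewrite subr_ge0 ltW.
  - by rewrite lerBlDr lerDl ltW.
  - exact: ABM (Aa n) (Bb n).
have [K cK BK] : exists2 K : set E, weakly_compact K & mimage B (range x) `<=` K.
  apply/rel_weakly_compact_sub/B_wcompact; first by move=> _ [n _ <-].
  by apply/bounded_setP; exists M => _ [n _ <-].
have Kb n : K (b n) by apply: BK; exists (x n) => //; exists n.
have [phi [ip [b0 _ bphi]]] := weakly_compact_subseq cK Kb.
have sm : weak_cvg (fun n => s n *: (x0 - (a n + b n))) 0.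
  apply: cvg_weak_cvg; apply/cvgrPdist_lt => e e0.
  have M2 : 0 < M + M + 1.
    by rewrite ltr_wpDl// addr_ge0// (le_trans _ x0M).
  apply: filterS (epsP _ (divr_gt0 e0 M2)) => n; rewrite ltr_pdivlMr// => en.
  rewrite sub0r normrN normrZ gtr0_norm//; apply: le_lt_trans en.
  apply: ler_pM => //; [exact: ltW|exact: ltW (se n)|].
  apply: le_trans (ler_normB _ _) _.
  apply: le_trans (lerD x0M (ABM _ _ _ (Sx n) (Aa n) (Bb n))) _.
  by rewrite lerDl.
have dphi : weak_cvg (fun n => x (phi n) - a (phi n)) b0.
  have := weak_cvgD bphi (weak_cvg_subseq ip sm); rewrite addr0.
  by under [X in weak_cvg X _ -> _]eq_fun do rewrite /= -xE.
have [|psi [ipsi [l xl]]] := A_hemi (x \o phi) (a \o phi) (fun n => Sx _) (fun n => Aa _).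
  by exists b0.
have Sl : S l by apply: (weak_lim_closed_cvx S_closed S_cvx _ xl) => n; exact: Sx.
have bl := weak_cvg_subseq ipsi bphi.
(* [a = x - (x - a)], and both terms now converge weakly. *)
have al : weak_cvg (a \o phi \o psi) (l - b0).
  have := weak_cvgB xl (weak_cvg_subseq ipsi dphi).
  by under [X in weak_cvg X _ -> _]eq_fun do rewrite /= subKr.
exists l => //; exists (l - b0); last exists b0; last by rewrite subrK.
  by apply: (A_graph (x \o phi \o psi) (a \o phi \o psi)) => // n; [exact: Sx|exact: Aa].
by apply: (B_graph (x \o phi \o psi) (b \o phi \o psi)) => // n; [exact: Sx|exact: Bb].
Qed.
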